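(* There are constants $C,D>0$ such that $$Da^2\le\log a+\beta_c(a)-\beta_c\le Ca$$ for all $a>0$ small enough. In particular, the constant pinning functions $\varphi_a\equiv\beta_c(a)$ satisfy Condition (A), that is, there are $a_0>0$ and $C'>0$ such that $-C'\le\frac1a\log\int_0^ae^{\beta_c(a)-\beta_c}dx\le C'$ for all $0<a<a_0$; and moreover $a\,e^{\beta_c(a)}\to e^{\beta_c}$ as $a\to0$.
   Context: Random walk. $V:\mathbb R\to\mathbb R$ is $C^2$, symmetric ($V(x)=V(-x)$), with $V''(x)\in[1/c,c]$ for all $x$ for some constant $c>1$. $\rho(x)=\frac1\kappa e^{-V(x)}$ is a probability density with $\int x^2\rho(x)\,dx=1$. Kernels. For $a\ge0$ and $x,y\in[0,a]$ put $f^a_1(x,y)=\rho(y-x)$ and, for $n\ge2$, $$f^a_n(x,y)=\int_{(a,\infty)^{n-1}}\rho(s_1-x)\rho(s_2-s_1)\cdots\rho(s_{n-1}-s_{n-2})\rho(y-s_{n-1})\,ds_1\cdots ds_{n-1},$$ i.e. $f_n^a(x,y)dy=\mathbb P_x[S_1>a,\dots,S_{n-1}>a,S_n\in dy]$ for the random walk $S$ started at $x$ with i.i.d. increments of density $\rho$. Put $f_n=f_n^0(0,0)$. Critical value of the standard wetting model: $\beta_c\in\mathbb R$ is defined by $e^{-\beta_c}=\sum_{n\ge1}f_n$. Critical value of the strip wetting model with constant pinning: for $a>0$ let $b^a_0(x,y)=\sum_{n\ge1}f^a_n(x,y)$, $x,y\in[0,a]$. This is the kernel of a Hilbert–Schmidt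 integral operator on $L^2([0,a])$ with strictly positive continuous symmetric kernel; let $\delta_a(0)$ be its principal (largest, Perron–Frobenius) eigenvalue, the one with a strictly positive continuous eigenfunction. Then $\beta_c(a):=-\log\delta_a(0)$. *)

(* Defs.v *)
From HB Require Import structures.
From mathcomp Require Import all_boot all_order all_algebra.
From mathcomp Require Import all_classical all_reals all_analysis.

Set Implicit Arguments.
Unset Strict Implicit.
Unset Printing Implicit Defensive.

Import Order.TTheory GRing.Theory Num.Theory.
Import numFieldNormedType.Exports.

Local Open Scope classical_set_scope.
Local Open Scope ring_scope.

Definition incr_density (R : realType) (V : R -> R) (kappa : R) (x : R) : R :=
  kappa^-1 * expR (- V x).

(* The (n-1)-fold integral over (a, +oo)^(n-1) is written as an iterated
   integral, s_1 outermost; the integrand is nonnegative, so nothing is lost,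
   and values are extended reals.  Indices start at n = 1: the value at n = 0
   is a dummy.  The kernel is defined for all real x, since the recursion
   evaluates it at x = s_1 > a. *)
Fixpoint walk_kernel (R : realType) (rho : R -> R) (a : R) (n : nat)
    (x y : R) : \bar R :=
  match n with
  | 0%N => 0%E
  | m.+1 =>
      if m == 0%N then (rho (y - x))%:E
      else (\int[@lebesgue_measure R]_(s in `]a, +oo[)
              ((rho (s - x))%:E * walk_kernel rho a m s y))%E
  end.

Definition sum_kernel (R : realType) (rho : R -> R) (a x y : R) : \bar R :=
  (\sum_(1 <= n <oo) walk_kernel rho a n x y)%E.

Definition beta_c (R : realType) (rho : R -> R) : R :=
  - ln (fine (\sum_(1 <= n <oo) walk_kernel rho 0 n 0 0)%E).

(* For a symmetric kernel the integral operator is self-adjoint, so real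
   eigenvalues with real eigenfunctions suffice. *)
Definition L2_eigenvalue (R : realType) (a : R) (K : R -> R -> \bar R)
    (l : R) : Prop :=
  exists g : R -> R,
    [/\ measurable_fun `[0, a] g,
        (\int[@lebesgue_measure R]_(x in `[0%R, a]) ((g x) ^+ 2)%:E < +oo)%E,
        ~ {ae @lebesgue_measure R, forall x, x \in `[0, a] -> g x = 0} &
        {ae @lebesgue_measure R, forall x, x \in `[0, a] ->
          (\int[@lebesgue_measure R]_(y in `[0%R, a]) (K x y * (g y)%:E)
           = (l * g x)%:E)%E}].

Definition principal_eigenvalue (R : realType) (a : R) (K : R -> R -> \bar R)
    (l : R) : Prop :=
  (exists h : R -> R,
    [/\ {within `[0, a], continuous h},
        (forall x, x \in `[0, a] -> 0 < h x) &
        (forall x, x \in `[0, a] ->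
          (\int[@lebesgue_measure R]_(y in `[0%R, a]) (K x y * (h y)%:E)
           = (l * h x)%:E)%E)]) /\
  (forall l', L2_eigenvalue a K l' -> l' <= l).

(* At most one l satisfies principal_eigenvalue when 0 < a; the default 0 is
   taken only if there is none. *)
Definition delta0 (R : realType) (rho : R -> R) (a : R) : R :=
  xget 0 [set l | principal_eigenvalue a (sum_kernel rho a) l].

Definition beta_c_strip (R : realType) (rho : R -> R) (a : R) : R :=
  - ln (delta0 rho a).

(* phi a is the pinning function on the strip [0, a] *)
Definition condition_A (R : realType) (rho : R -> R) (phi : R -> R -> R) :
    Prop :=
  exists a0 C : R, [/\ 0 < a0, 0 < C &
    forall a, 0 < a -> a < a0 ->
      - C <= a^-1 * ln (\int[@lebesgue_measure R]_(x in `[0, a])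
                          expR (phi a x - beta_c rho)) <= C].

(* Main.v *)
(** Translating the strip [0, a] to [-a, 0], the kernel b_0^a(x, y) becomes
    rho(y - x) + L(x - a, y - a), where L = P G rho and G is the Green operator
    of the walk killed outside (0, oo).  At a = 0 this kernel is
    B = e^{-beta_c} = rho(0) + L(0, 0), so that the quantity to estimate is
    - ln (delta_a(0) / (a B)).

    G is controlled by a barrier: W(s) = 4 - min(e^{-s}, 4) satisfies
    P W + eta e^{-s} <= W on s > 0, hence G applied to e^{-s} is at most 4/eta.
    As rho is log-concave with Gaussian tails, |rho'(t)| <= C e^{-|t|}, so L is
    finite and Lipschitz, and b_0^a >= B - c_1 a on the strip.  Since rho
    decreases away from 0, L <= L(0, 0), and b_0^a <= B - D (y - x)^2.  The
    principal eigenvalue lies between the extreme row sums of the kernel, which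
    yields a (B - c_1 a) <= delta_a(0) <= a (B - D a^2 / 64).

    For small a the kernel is almost constant, so f |-> K f / (K f)(0) contracts
    the sup norm; its fixed point is the Perron-Frobenius eigenfunction. *)

Require Import Defs.
From HB Require Import structures.
From mathcomp Require Import all_boot all_order all_algebra.
From mathcomp Require Import all_classical all_reals all_analysis.
From mathcomp Require Import measurable_realfun.
From mathcomp Require Import ring lra.

Set Implicit Arguments.
Unset Strict Implicit.
Unset Printing Implicit Defensive.

Import Order.TTheory GRing.Theory Num.Theory.
Import numFieldNormedType.Exports.

Local Open Scope classical_set_scope.
Local Open Scope ring_scope.

(** * Calculus on the real line *)

Section real_functions.
Context (R : realType).

Lemma derive_continuous (f : R -> R) :
  (forall x : R, derivable f x 1) -> continuous f.
Proof.
by move=> df x; apply/differentiable_continuous; apply/derivable1_diffP/df.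
Qed.

Lemma MVT_line (f df : R -> R) (x y : R) :
  (forall z : R, is_derive z (1 : R) f (df z)) -> x <= y ->
  exists2 z, x <= z <= y & f y - f x = df z * (y - x).
Proof.
move=> fdf xy.
have cf : continuous f by apply: derive_continuous => z; case: (fdf z).
have [|z zxy e] := MVT_segment xy (fun z _ => fdf z).
  exact: continuous_subspaceT.
by exists z => //; move: zxy; rewrite in_itv.
Qed.

Lemma lipschitz_continuous (f : R -> R) (k : R) :
  (forall x y, `|f x - f y| <= k * `|x - y|) -> continuous f.
Proof.
move=> h x; apply/cvgrPdist_le => e e0.
have k0 : 0 <= k.
  by have := h 1 0; rewrite subr0 normr1 mulr1; apply: le_trans.
(* Dividing by [k + 1] rather than by [k] covers [k = 0]. *)
have d0 : 0 < e / (k + 1) by rewrite divr_gt0// ltr_wpDl.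
apply/nbhs_ballP; exists (e / (k + 1)) => //= t /ltW xt.
apply: le_trans (h x t) _.
apply: (@le_trans _ _ (k * (e / (k + 1)))); first by rewrite ler_wpM2l.
by rewrite mulrCA ler_piMr ?ltW// ltr_pdivrMr ?ltr_wpDl// mul1r ltrDl.
Qed.

End real_functions.

(** * The increment density *)

(** These are the properties of the increment law from which everything after this part is derived.
    In [rd_lip] the slope decays with the distance [s] to the origin, which makes the resolvent part
    of the kernel Lipschitz; [rd_quad] is the source of the quadratic lower bound. *)
Record regular_density (R : realType) (rho : R -> R) (C D : R) : Prop :=
  RegularDensity {
    rd_C_gt0 : 0 < C;
    rd_D_gt0 : 0 < D;
    rd_gt0 : forall x : R, 0 < rho x;
    rd_even : forall x : R, rho (- x) = rho x;
    rd_decr : forall x y : R, 0 <= x -> x <= y -> rho y <= rho x;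
    rd_exp : forall x : R, 0 <= x -> rho x <= C * expR (- x);
    rd_lip : forall s x y : R, 0 <= s -> s <= x -> s <= y ->
      `|rho x - rho y| <= C * expR (- s) * `|x - y|;
    rd_quad : forall x : R, `|x| <= 1 -> D * x ^+ 2 <= rho 0 - rho x;
    rd_mass : (\int[@lebesgue_measure R]_x (rho x)%:E = 1)%E }.

Section strongly_convex_potential.
Context (R : realType) (V : R -> R) (c kappa : R).
Hypotheses (V_derivable : forall x : R, derivable V x 1)
  (dV_derivable : forall x : R, derivable (V^`())%classic x 1)
  (V_even : forall x : R, V (- x) = V x)
  (c_gt1 : 1 < c)
  (ddV_bounds : forall x : R, c^-1 <= (V^`(2))%classic x <= c)
  (kappa_gt0 : 0 < kappa).

Local Notation V' := (V^`())%classic.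
Local Notation rho := (incr_density V kappa).

Lemma is_derive_V (x : R) : is_derive x 1 V (V' x).
Proof. by rewrite derive1E; exact/derivableP. Qed.

Lemma is_derive_dV (x : R) : is_derive x 1 V' ((V^`(2))%classic x).
Proof. by rewrite derive1nS derive1n1 derive1E; exact/derivableP. Qed.

Lemma dV0 : V' 0 = 0.
Proof.
have h : V' 0 = - V' 0.
  have {1}-> : V = V \o -%R by apply/funext => x /=; rewrite V_even.
  rewrite derive1_comp//.
  by rewrite derive1N// derive1_id oppr0 mulrN1.
lra.
Qed.

Lemma dV_bounds (x : R) : 0 <= x -> x / c <= V' x <= c * x.
Proof.
move=> x0; have [z _] := MVT_line is_derive_dV x0.
rewrite dV0 !subr0 => ->; have /andP[h1 h2] := ddV_bounds z.
by rewrite mulrC ler_wpM2r//= ler_wpM2r.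
Qed.

Lemma V_ndecr (x y : R) : 0 <= x -> x <= y -> V x <= V y.
Proof.
move=> x0 xy; have [z /andP[xz zy] e] := MVT_line is_derive_V xy.
rewrite -subr_ge0 e mulr_ge0 ?subr_ge0//.
have z0 := le_trans x0 xz; have /andP[+ _] := dV_bounds z0.
by apply: le_trans; rewrite divr_ge0// ltW// (lt_trans ltr01).
Qed.

(** On [x/2, x] the derivative is at least x/(2c), so the mean value theorem gives x^2/(4c) there;
    monotonicity takes care of [0, x/2]. *)
Lemma V_growth (x : R) : x ^+ 2 / (4 * c) <= V x - V 0.
Proof.
have c0 : 0 < c := lt_trans ltr01 c_gt1.
wlog x0 : x / 0 <= x.
  move=> h; have [/h//|/ltW x0] := leP 0 x.
  by rewrite -V_even -sqrrN; apply: h; rewrite oppr_ge0.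
have x2 : x / 2 <= x by rewrite ler_pdivrMr// ler_peMr// ler1n.
have [z /andP[xz zy] e] := MVT_line is_derive_V x2.
have hx0 : 0 <= x / 2 by rewrite divr_ge0.
have /andP[h _] := dV_bounds (le_trans hx0 xz).
have V0 := V_ndecr (lexx 0) hx0.
have : x / 2 / c * (x / 2) <= V x - V (x / 2).
  rewrite e (_ : x - x / 2 = x / 2); last by field.
  by rewrite ler_wpM2r// (le_trans _ h)// ler_wpM2r// invr_ge0 ltW.
rewrite (_ : x / 2 / c * (x / 2) = x ^+ 2 / (4 * c)); first lra.
by field; rewrite gt_eqF.
Qed.

Lemma is_derive_incr_density (x : R) : is_derive x 1 rho (- V' x * rho x).
Proof.
have h := is_derive_V x.
rewrite (_ : rho = (fun x => kappa^-1 *: expR (- V x))) //.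
apply: is_derive_eq.
by rewrite /GRing.scale /= /incr_density; ring.
Qed.

Lemma incr_density_gt0 x : 0 < rho x.
Proof. by rewrite mulr_gt0 ?invr_gt0 ?expR_gt0. Qed.

Let C := c * kappa^-1 * expR (4 * c - V 0).

(** The term [4 * c] in [C] comes from completing the square in [2 * x <= x ^+ 2 / (4 * c) + 4 * c].
    The rate 2 leaves a spare factor [expR (- x)] to absorb the linear growth of [V'] in the
    derivative of [rho]. *)
Lemma incr_density_exp (x : R) : 0 <= x -> rho x <= C / c * expR (- (2 * x)).
Proof.
have c0 : 0 < c := lt_trans ltr01 c_gt1.
move=> x0; rewrite /C /incr_density.
rewrite (_ : c * kappa^-1 * expR (4 * c - V 0) / c =
   kappa^-1 * expR (4 * c - V 0)); last by field; rewrite !gt_eqF.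
rewrite -mulrA -expRD ler_pM2l ?invr_gt0// ler_expR.
have := V_growth x.
suff : 2 * x <= x ^+ 2 / (4 * c) + 4 * c by lra.
rewrite -subr_ge0 (_ : _ - _ = (x - 4 * c) ^+ 2 / (4 * c)).
  by rewrite divr_ge0 ?sqr_ge0// mulr_ge0// ltW.
by field; rewrite gt_eqF.
Qed.

Lemma incr_density_regular :
  (\int[@lebesgue_measure R]_x (rho x)%:E = 1)%E ->
  regular_density rho C (rho 0 / (8 * c)).
Proof.
have c0 : 0 < c := lt_trans ltr01 c_gt1.
move=> mass.
have C0 : 0 < C by rewrite /C !mulr_gt0 ?invr_gt0 ?expR_gt0.
split => //.
- by rewrite divr_gt0 ?incr_density_gt0// mulr_gt0.
- exact: incr_density_gt0.
- by move=> x; rewrite /incr_density V_even.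
- move=> x y x0 xy; rewrite ler_pM2l ?invr_gt0// ler_expR lerN2.
  exact: V_ndecr.
- move=> x x0; rewrite (le_trans (incr_density_exp x0))//.
  apply: ler_pM; rewrite ?expR_ge0 ?ler_expR//; last by lra.
    by rewrite divr_ge0// ltW.
  by rewrite ler_pdivrMr// ler_peMr// ltW.
- move=> s x y s0 sx sy.
  wlog xy : x y sx sy / x <= y.
    move=> h; have [/h|/ltW/h] := leP x y; first exact.
    by rewrite distrC (distrC x); apply.
  rewrite distrC (distrC x).
  have [z /andP[xz zy] ->] := MVT_line is_derive_incr_density xy.
  rewrite normrM ler_wpM2r//.
  have z0 : 0 <= z by rewrite (le_trans s0)// (le_trans sx).
  have /andP[h1 h2] := dV_bounds z0.
  have V'0 : 0 <= V' z by rewrite (le_trans _ h1)// divr_ge0// ltW.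
  rewrite normrM normrN (ger0_norm V'0) (gtr0_norm (incr_density_gt0 z)).
  (* The derivative of [rho] at [z] is at most [C * z * expR (- (2 * z))] in absolute value, and
     [z <= expR z]. *)
  apply: (@le_trans _ _ (c * z * (C / c * expR (- (2 * z))))).
    by apply: ler_pM => //; [exact/ltW/incr_density_gt0|exact: incr_density_exp].
  rewrite (_ : c * z * _ = C * (z * expR (- (2 * z)))); last first.
    by field; rewrite gt_eqF.
  rewrite ler_pM2l// (@le_trans _ _ (expR z * expR (- (2 * z))))//.
    rewrite ler_wpM2r ?expR_ge0//.
    by apply: le_trans (expR_ge1Dx z); rewrite lerDr.
  by rewrite -expRD ler_expR; have := le_trans sx xz; lra.
- move=> x x1; set z := x ^+ 2 / (4 * c).
  have z0 : 0 <= z by rewrite divr_ge0 ?sqr_ge0// mulr_ge0// ltW.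
  have z1 : z <= 1.
    rewrite ler_pdivrMr ?mulr_gt0// mul1r.
    apply: (@le_trans _ _ 1); last by move: c_gt1; lra.
    by rewrite -real_normK ?num_real// expr_le1.
  have hz : rho x <= rho 0 * expR (- z).
    rewrite /incr_density -mulrA -expRD ler_pM2l ?invr_gt0// ler_expR.
    by have := V_growth x; rewrite -/z; lra.
  (* Follows from [1 + z <= expR z] and (1 - z/2)(1 + z) >= 1 on [0, 1]. *)
  have e : expR (- z) <= 1 - z / 2.
    rewrite expRN -ler_pV2 ?invrK ?inE ?unitfE ?gt_eqF ?expR_gt0 ?invr_gt0//;
      try by rewrite ?expR_gt0//; lra.
    apply: le_trans (expR_ge1Dx z).
    rewrite -div1r ler_pdivrMr; last lra.
    by nra.
  have := ler_wpM2l (ltW (incr_density_gt0 0)) e => {}e.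
  rewrite (_ : rho 0 / (8 * c) * x ^+ 2 = rho 0 * (z / 2)); first lra.
  by rewrite /z; field; rewrite gt_eqF.
Qed.

End strongly_convex_potential.

(** * Principal eigenvalue of an almost constant kernel *)

Section geometric_limits.
Context (R : realType).

(** The eigenfunction arguments below take their limits in this form, through explicit geometric
    errors. *)
Lemma le0_of_le_geometric (x M q : R) : 0 <= q < 1 ->
  (forall n, x <= M * q ^+ n) -> x <= 0.
Proof.
move=> /andP[q0 q1] h; have nq : `|q| < 1 by rewrite ger0_norm.
have cv := @cvg_geometric R M q nq.
rewrite -(cvg_lim (@Rhausdorff R) cv); apply: limr_ge.
  by apply/cvg_ex; exists 0.
by apply: nearW => n; exact: h.
Qed.

(** With [r n] the tail of the dominating geometric series, [u n - r n] is nondecreasing and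
    [u n + r n] nonincreasing, so the intervals between them are nested; the limit is the supremum
    of the left ends. *)
Lemma geometric_limit (u : R^nat) (M q : R) : 0 <= q < 1 ->
  (forall n, `|u n.+1 - u n| <= M * q ^+ n) ->
  exists l, forall n, `|u n - l| <= M / (1 - q) * q ^+ n.
Proof.
move=> /andP[q0 q1] h; pose r n := M / (1 - q) * q ^+ n.
have q'0 : 0 < 1 - q by rewrite subr_gt0.
have M0 : 0 <= M.
  by have := h 0%N; rewrite expr0 mulr1; apply: le_trans.
have r0 n : 0 <= r n by rewrite mulr_ge0 ?exprn_ge0// divr_ge0// ltW.
have rS n : r n - r n.+1 = M * q ^+ n.
  by rewrite /r exprS; field; rewrite gt_eqF.
have up : {homo (fun n => u n - r n) : i j / (i <= j)%N >-> i <= j}.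
  apply: homo_leq => [//|y x z|n]; first exact: le_trans.
  by have := h n; rewrite ler_norml => /andP[+ _]; have := rS n; lra.
have dn : {homo (fun n => u n + r n) : i j / (i <= j)%N >-> j <= i}.
  apply: (homo_leq (r := fun x y => y <= x)) => [//|y x z xy yz|n].
    exact: le_trans yz xy.
  by have := h n; rewrite ler_norml => /andP[_ +]; have := rS n; lra.
have ud i j : u i - r i <= u j + r j.
  apply: le_trans (up _ _ (leq_maxl i j)) _.
  apply: le_trans _ (dn _ _ (leq_maxr i j)).
  by have := r0 (maxn i j); lra.
pose E := range (fun n => u n - r n).
exists (sup E) => n; rewrite ler_norml -/(r n).
have h1 : u n - r n <= sup E.
  apply: ub_le_sup; last by exists n.
  by exists (u 0%N + r 0%N) => _ [i _ <-].
have h2 : sup E <= u n + r n.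
  apply: ge_sup; first by exists (u n - r n), n.
  by move=> _ [i _ <-].
by apply/andP; split; lra.
Qed.

End geometric_limits.

Section bounded_measurable.
Context (R : realType).
Notation mu := (@lebesgue_measure R).

Definition bounded_measurable (f : R -> R) :=
  measurable_fun [set: R] f /\ exists M, forall x, `|f x| <= M.

Lemma bounded_measurable_cst k : bounded_measurable (fun=> k).
Proof. by split; [exact: measurable_cst | exists `|k|]. Qed.

Lemma bounded_measurableM f g : bounded_measurable f -> bounded_measurable g ->
  bounded_measurable (fun x => f x * g x).
Proof.
move=> [mf [M fM]] [mg [N gN]]; split; first exact: measurable_funM.
by exists (M * N) => x; rewrite normrM ler_pM.
Qed.

Lemma bounded_measurableB f g : bounded_measurable f -> bounded_measurable g ->
  bounded_measurable (fun x => f x - g x).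
Proof.
move=> [mf [M fM]] [mg [N gN]]; split; first exact: measurable_funB.
by exists (M + N) => x; rewrite (le_trans (ler_normB _ _))// lerD.
Qed.

Lemma bounded_measurable_integrable (a b : R) f : bounded_measurable f ->
  mu.-integrable `[a, b] (EFin \o f).
Proof.
move=> [mf [M fM]]; apply: measurable_bounded_integrable => //.
- by rewrite /= lebesgue_measure_itv/=; case: ifP; rewrite ltry.
- exact: measurable_funS mf.
- exists M; split; first exact: num_real.
  by move=> N MN x _; exact: le_trans (fM x) (ltW MN).
Qed.

End bounded_measurable.

(** * Perron-Frobenius eigenfunction as a contraction fixed point *)

Section perron_frobenius.
Context (R : realType) (a m B L : R) (K : R -> R -> R).
Notation mu := (@lebesgue_measure R).
Hypotheses (a_gt0 : 0 < a) (m_gt0 : 0 < m)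
  (K_bounds : forall x y, m <= K x y <= B)
  (K_lip : forall x x' y, `|K x y - K x' y| <= L * `|x - x'|)
  (K_meas : forall x, measurable_fun [set: R] (K x)).

(** Since [K] lies in [m, B], the normalised image of a positive function lies in [q, 1/q]. [theta]
    is the contraction factor of the normalised operator in the sup norm; it is small when [m] is
    close to [B]. *)
Let q := m / B.
Let theta := (B ^+ 2 - m ^+ 2) / (m ^+ 2 * q).
Hypothesis theta_lt1 : theta < 1.

Local Notation S f := (\int[mu]_(y in `[0%R, a]) f y).
Local Notation T f x := (\int[mu]_(y in `[0%R, a]) (K x y * f y)).
Local Notation N f x := (T f x / T f 0).
Local Notation bm := bounded_measurable.

Let mB : m <= B.
Proof. by have /andP[h1 h2] := K_bounds 0 0; exact: le_trans h1 h2. Qed.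

Let B_gt0 : 0 < B. Proof. exact: lt_le_trans m_gt0 mB. Qed.

Let q_gt0 : 0 < q. Proof. exact: divr_gt0. Qed.

Let q_le1 : q <= 1. Proof. by rewrite ler_pdivrMr// mul1r. Qed.

Let theta_ge0 : 0 <= theta.
Proof.
apply: divr_ge0; last by rewrite mulr_ge0 ?sqr_ge0// ltW.
by rewrite subr_ge0 lerXn2r// nnegrE ltW.
Qed.

Let L_ge0 : 0 <= L.
Proof.
have := K_lip 1 0 0; rewrite subr0 normr1 mulr1; apply: le_trans.
exact: normr_ge0.
Qed.

Let bmK x : bm (K x).
Proof.
split=> //; exists B => y; have /andP[h1 h2] := K_bounds x y.
by rewrite ger0_norm// (le_trans _ h1)// ltW.
Qed.

Let int_bm f : bm f -> mu.-integrable `[0%R, a] (EFin \o f).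
Proof. exact: bounded_measurable_integrable. Qed.

Let int_K x f : bm f -> mu.-integrable `[0%R, a] (EFin \o (fun y => K x y * f y)).
Proof. by move=> bf; apply: int_bm; exact: bounded_measurableM. Qed.

Let S_cst k : S (fun=> k) = k * a.
Proof.
by rewrite Rintegral_cst//= lebesgue_measure_itv/= lte_fin a_gt0 sube0.
Qed.

Let S_le f g : bm f -> bm g -> (forall x, f x <= g x) -> S f <= S g.
Proof. by move=> bf bg fg; apply: le_Rintegral => //; exact: int_bm. Qed.

Let S_norm f e : bm f -> (forall x, `|f x| <= e) -> `|S f| <= e * a.
Proof.
move=> bf fe; rewrite ler_norml -mulNr -!S_cst.
by apply/andP; split; apply: S_le => //;
  try exact: bounded_measurable_cst; move=> x; have := fe x;
  rewrite ler_norml => /andP[].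
Qed.

Let T_bounds f x : bm f -> (forall y, 0 <= f y) -> m * S f <= T f x <= B * S f.
Proof.
move=> bf f0; rewrite -!RintegralZl//; try exact: int_bm.
by apply/andP; split; apply: S_le => //;
  try (by apply: bounded_measurableM => //; exact: bounded_measurable_cst);
  move=> y; rewrite ler_wpM2r//; have /andP[] := K_bounds x y.
Qed.

Let TB f g x : bm f -> bm g -> T (fun y => f y - g y) x = T f x - T g x.
Proof.
move=> bf bg; rewrite -RintegralB//; try exact: int_K.
by apply: eq_Rintegral => y _; rewrite mulrBr.
Qed.

Let T_norm f e x : bm f -> (forall y, `|f y| <= e) -> `|T f x| <= B * e * a.
Proof.
move=> bf fe; apply: S_norm; first exact: bounded_measurableM.
move=> y; rewrite normrM ler_pM//; have /andP[h1 h2] := K_bounds x y.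
by rewrite ger0_norm// (le_trans _ h1)// ltW.
Qed.

Let T_lip f x x' : bm f -> (forall y, 0 <= f y) ->
  `|T f x - T f x'| <= L * `|x - x'| * S f.
Proof.
move=> bf f0; rewrite -RintegralB//; try exact: int_K.
rewrite ler_norml -mulNr -!RintegralZl//; try exact: int_bm.
have bd : bm (fun y => K x y * f y - K x' y * f y).
  by apply: bounded_measurableB; exact: bounded_measurableM.
by apply/andP; split; apply: S_le => //;
  try (by apply: bounded_measurableM => //; exact: bounded_measurable_cst);
  move=> y; rewrite -mulrBl ler_wpM2r//; have := K_lip x x' y;
  rewrite ler_norml => /andP[].
Qed.

(** A set invariant under [f |-> N f] that contains the constant 1; the lower bound keeps [T f 0]
    away from 0. *)
Let adm f := bm f /\ forall x, q <= f x <= q^-1.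

Let adm_ge0 f : adm f -> forall x, 0 <= f x.
Proof.
by move=> [_ h] x; have /andP[+ _] := h x; apply: le_trans; exact: ltW.
Qed.

Let adm_S f : adm f -> q * a <= S f.
Proof.
move=> [bf h]; rewrite -S_cst; apply: S_le => //.
  exact: bounded_measurable_cst.
by move=> x; have /andP[] := h x.
Qed.

Let adm_S_gt0 f : adm f -> 0 < S f.
Proof. by move=> /adm_S; apply: lt_le_trans; exact: mulr_gt0. Qed.

Let adm_T_gt0 f x : adm f -> 0 < T f x.
Proof.
move=> af; have [bf _] := af.
have /andP[+ _] := T_bounds x bf (adm_ge0 af); apply: lt_le_trans.
by rewrite mulr_gt0// adm_S_gt0.
Qed.

(** The constant is the same for all [f]: it makes every iterate measurable and survives in the
    limit, where it gives continuity of the eigenfunction. *)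
Let N_lip f x x' : adm f -> `|N f x - N f x'| <= L / m * `|x - x'|.
Proof.
move=> af; have [bf _] := af; have T0 := adm_T_gt0 0 af.
have Sf := adm_S_gt0 af.
rewrite -mulrBl normrM [`|_^-1|]gtr0_norm ?invr_gt0// ler_pdivrMr//.
apply: (le_trans (T_lip x x' bf (adm_ge0 af))).
have /andP[h _] := T_bounds 0 bf (adm_ge0 af).
rewrite (_ : L * _ * _ = L / m * `|x - x'| * (m * S f)).
  by rewrite ler_wpM2l// mulr_ge0// divr_ge0// ltW.
by field; rewrite gt_eqF.
Qed.

Let adm_N f : adm f -> adm (fun x => N f x).
Proof.
move=> af; have [bf _] := af; have T0 := adm_T_gt0 0 af.
have Nb x : q <= N f x <= q^-1.
  have /andP[h1 h2] := T_bounds x bf (adm_ge0 af).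
  have /andP[h3 h4] := T_bounds 0 bf (adm_ge0 af).
  have Sf := adm_S_gt0 af.
  rewrite ler_pdivlMr// ler_pdivrMr//; apply/andP; split.
    apply: (@le_trans _ _ (q * (B * S f))); first by rewrite ler_pM2l.
    by rewrite mulrA /q divfK// gt_eqF.
  apply: le_trans h2 _; apply: (@le_trans _ _ (q^-1 * (m * S f))).
    by rewrite mulrA /q invf_div divfK// gt_eqF.
  by rewrite ler_pM2l// invr_gt0.
split => //; split.
  apply: continuous_measurable_fun; apply: lipschitz_continuous => x y.
  exact: N_lip.
exists q^-1 => x; have /andP[h1 h2] := Nb x.
by rewrite ger0_norm// (le_trans _ h1)// ltW.
Qed.

(* With d = f - g, the numerator T f x * T g 0 - T g x * T f 0 of N f x - N g x is
   the integral of d against K x y * T g 0 - T g x * K 0 y, which is small because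
   both products lie between m^2 S g and B^2 S g. *)
Let N_contraction f g e x : adm f -> adm g -> (forall y, `|f y - g y| <= e) ->
  `|N f x - N g x| <= theta * e.
Proof.
move=> af ag fge; have [bf _] := af; have [bg _] := ag.
have Sf := adm_S_gt0 af; have Sg := adm_S_gt0 ag.
have Tf := adm_T_gt0 0 af; have Tg := adm_T_gt0 0 ag.
have e0 : 0 <= e by rewrite (le_trans _ (fge 0)).
pose d y := f y - g y.
have bd : bm d by exact: bounded_measurableB.
pose k y := K x y * T g 0 - T g x * K 0 y.
have bk : bm k.
  by apply: bounded_measurableB; apply: bounded_measurableM => //;
    exact: bounded_measurable_cst.
have num : T f x * T g 0 - T g x * T f 0 = S (fun y => d y * k y).
  have -> : S (fun y => d y * k y) =
      S (fun y => T g 0 * (K x y * d y) - T g x * (K 0 y * d y)).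
    by apply: eq_Rintegral => y _; rewrite /k; ring.
  rewrite RintegralB//; last 2 first.
    by apply: int_bm; apply: bounded_measurableM;
      [exact: bounded_measurable_cst|exact: bounded_measurableM].
    by apply: int_bm; apply: bounded_measurableM;
      [exact: bounded_measurable_cst|exact: bounded_measurableM].
  have TdE x' k' : S (fun y => k' * (K x' y * d y)) = k' * (T f x' - T g x').
    by rewrite RintegralZl ?TB//; exact: int_K.
  by rewrite !TdE; ring.
have kb y : `|k y| <= (B ^+ 2 - m ^+ 2) * S g.
  have /andP[a1 a2] := T_bounds 0 bg (adm_ge0 ag).
  have /andP[a3 a4] := T_bounds x bg (adm_ge0 ag).
  have /andP[b1 b2] := K_bounds x y; have /andP[b3 b4] := K_bounds 0 y.
  have mS : 0 <= m * S g by rewrite mulr_ge0// ltW.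
  have m0 := ltW m_gt0.
  have c1 := ler_pM m0 mS b1 a1.
  have c2 := ler_pM (le_trans m0 b1) (le_trans mS a1) b2 a2.
  have c3 := ler_pM m0 mS b3 a3.
  have c4 := ler_pM (le_trans m0 b3) (le_trans mS a3) b4 a4.
  rewrite /k ler_norml; move: c1 c2 c3 c4; rewrite !mulrA -!expr2.
  by move=> c1 c2 c3 c4; apply/andP; split; lra.
have -> : N f x - N g x = S (fun y => d y * k y) / (T f 0 * T g 0).
  by rewrite -num; field; rewrite !gt_eqF.
rewrite normrM [`|_^-1|]gtr0_norm ?invr_gt0 ?mulr_gt0// ler_pdivrMr ?mulr_gt0//.
have B2 : 0 <= B ^+ 2 - m ^+ 2 by rewrite subr_ge0 lerXn2r// nnegrE ltW.
apply: (@le_trans _ _ (e * ((B ^+ 2 - m ^+ 2) * S g) * a)).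
  apply: S_norm; first exact: bounded_measurableM.
  by move=> y; rewrite normrM ler_pM// fge.
have /andP[a1 _] := T_bounds 0 bg (adm_ge0 ag).
have /andP[a3 _] := T_bounds 0 bf (adm_ge0 af).
have mq : m * (q * a) <= T f 0.
  by apply: le_trans a3; rewrite ler_pM2l// adm_S.
(* The factors [S g] and [a] cancel against those of the numerator, so that [theta] depends on [m]
   and [B] only. *)
have den : m * (q * a) * (m * S g) <= T f 0 * T g 0.
  apply: ler_pM a1 => //; apply/ltW; last exact: mulr_gt0.
  by rewrite mulr_gt0// mulr_gt0.
apply: le_trans (ler_wpM2l (mulr_ge0 theta_ge0 e0) den).
rewrite le_eqVlt; apply/orP; left; apply/eqP; rewrite /theta.
by field; rewrite !gt_eqF.
Qed.

Let u n := iter n (fun f x => N f x) (fun=> 1).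

Let adm_u n : adm (u n).
Proof.
elim: n => [|n ih]; last exact: adm_N.
split; first exact: bounded_measurable_cst.
by move=> x; rewrite q_le1/= -[1]invr1 lef_pV2// posrE.
Qed.

Let u_lip n x y : `|u n x - u n y| <= L / m * `|x - y|.
Proof.
case: n => [|n]; last exact: N_lip.
by rewrite subrr normr0 mulr_ge0// divr_ge0// ltW.
Qed.

Let u_step n x : `|u n.+1 x - u n x| <= q^-1 * theta ^+ n.
Proof.
elim: n x => [|n ih] x.
  rewrite expr0 mulr1.
  have [_ /(_ x) /andP[h1 h2]] := adm_u 1.
  have [_ /(_ x) /andP[h3 h4]] := adm_u 0.
  by rewrite ler_norml; apply/andP; split; move: q_gt0; lra.
rewrite exprS mulrCA.
exact: (N_contraction x (adm_u n.+1) (adm_u n) ih).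
Qed.

(** The iterates [u n] converge pointwise with error [E * theta ^+ n]. The bounds, the Lipschitz
    constant and the eigenvalue equation pass to the limit with errors of the same order; the
    normalisation at 0 makes [T h 0] the eigenvalue. *)
Lemma perron_eigenfunction : exists h : R -> R,
  [/\ continuous h, bm h, (forall x, q <= h x), 0 < T h 0 &
      forall x, T h x = T h 0 * h x].
Proof.
have th01 : 0 <= theta < 1 by rewrite theta_ge0.
pose E := q^-1 / (1 - theta).
have /choice[h hE] : forall x, exists l, forall n,
    `|u n x - l| <= E * theta ^+ n.
  by move=> x; apply: (geometric_limit th01) => n; exact: u_step.
have hb x : q <= h x <= q^-1.
  have fin y : (forall n, y <= 2 * (E * theta ^+ n)) -> y <= 0.
    by move=> yE; apply: (@le0_of_le_geometric _ _ (2 * E) _ th01) => n;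
      rewrite -mulrA.
  apply/andP; split; rewrite -subr_le0; apply: fin => n;
    have [_ /(_ x) /andP[h1 h2]] := adm_u n;
    have := hE x n; rewrite ler_norml => /andP[h3 h4];
    have := le_trans (normr_ge0 _) (hE x n); lra.
have hl x y : `|h x - h y| <= L / m * `|x - y|.
  rewrite -subr_le0; apply: (@le0_of_le_geometric _ _ (2 * E) _ th01) => n.
  rewrite lerBlDl -lerBlDr.
  rewrite (_ : h x - h y = (u n x - u n y) - (u n x - h x) + (u n y - h y));
    last by ring.
  rewrite lerBlDr; apply: le_trans (ler_normD _ _) _.
  have := hE x n; have := hE y n; have := u_lip n x y.
  have := ler_normB (u n x - u n y) (u n x - h x); lra.
have bh : bm h.
  split; last first.
    exists q^-1 => x; have /andP[h1 h2] := hb x.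
    by rewrite ger0_norm// (le_trans _ h1)// ltW.
  by apply: continuous_measurable_fun; exact: lipschitz_continuous hl.
have ah : adm h by [].
exists h; split => //.
- exact: lipschitz_continuous hl.
- by move=> x; have /andP[] := hb x.
- exact: adm_T_gt0.
move=> x; pose F := B * a * q^-1.
have dT n y : `|T (u n) y - T h y| <= B * a * (E * theta ^+ n).
  have [bu _] := adm_u n; rewrite -TB//.
  rewrite mulrAC; apply: T_norm; first exact: bounded_measurableB.
  by move=> z; exact: hE.
have Th0 n : T (u n) x = u n.+1 x * T (u n) 0.
  by rewrite /= divfK// gt_eqF// adm_T_gt0//; exact: adm_u.
apply/eqP; rewrite -subr_eq0 -normr_le0.
pose G := B * a * E + B * a * q^-1 * E + B * a * E * q^-1.
apply: (@le0_of_le_geometric _ _ G _ th01) => n.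
(* The defect of [h] is compared with the exact relation [Th0] between [u n] and [u n.+1]; the three
   terms correspond to the three summands of [G]. *)
rewrite (_ : _ - _ = - (T (u n) x - T h x) + T (u n) 0 * (u n.+1 x - h x)
   + (T (u n) 0 - T h 0) * h x); last by rewrite Th0; ring.
have q1_ge0 : 0 <= q^-1 by rewrite invr_ge0 ltW.
have Ba0 : 0 <= B * a by rewrite mulr_ge0 ?ltW.
have hx : `|h x| <= q^-1.
  by have /andP[h1 h2] := hb x; rewrite ger0_norm// (le_trans _ h1)// ltW.
have uS : `|u n.+1 x - h x| <= E * theta ^+ n.
  apply: le_trans (hE x n.+1) _; rewrite exprS mulrCA ler_piMl//.
    exact: le_trans (normr_ge0 _) (hE x n).
  exact: ltW.
have Tu : `|T (u n) 0| <= B * a * q^-1.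
  have [bu ub] := adm_u n; rewrite mulrAC; apply: T_norm => // y.
  by have /andP[h1 h2] := ub y; rewrite ger0_norm// (le_trans _ h1)// ltW.
apply: le_trans (ler_normD _ _) _; rewrite [G * _]mulrDl; apply: lerD.
  apply: le_trans (ler_normD _ _) _; rewrite [X in _ <= X]mulrDl; apply: lerD.
    by rewrite normrN -mulrA; exact: dT.
  by rewrite normrM -mulrA; exact: ler_pM.
rewrite normrM mulrAC; apply: ler_pM => //.
by rewrite -[leRHS]mulrA; exact: dT.
Qed.

End perron_frobenius.

Lemma ae_imply (R : realType) (P Q : R -> Prop) : (forall x, P x -> Q x) ->
  {ae @lebesgue_measure R, forall x, P x} ->
  {ae @lebesgue_measure R, forall x, Q x}.
Proof.
move=> PQ h.
apply: (@filterS _ _ (ae_filter_ringOfSetsType (@lebesgue_measure R))) h.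
exact: PQ.
Qed.

(** * Maximality of the eigenvalue of a positive eigenfunction *)

Section principal_eigenvalue_of_positive_kernel.
Context (R : realType) (a B : R) (K : R -> R -> R) (Kx : R -> R -> \bar R).
Notation mu := (@lebesgue_measure R).
Hypotheses (a_gt0 : 0 < a)
  (K_bounds : forall x y, 0 <= K x y <= B)
  (K_meas : forall x, measurable_fun [set: R] (K x))
  (KxE : forall x y, x \in `[0, a] -> y \in `[0, a] -> Kx x y = (K x y)%:E).
Context (h : R -> R) (q l : R).
Hypotheses (h_cont : continuous h) (q_gt0 : 0 < q) (h_ge : forall x, q <= h x)
  (h_bm : bounded_measurable h) (l_gt0 : 0 < l)
  (h_eigen : forall x, \int[mu]_(y in `[0%R, a]) (K x y * h y) = l * h x).

Local Notation D := (`[0%R, a]%classic).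

Let bmK x : bounded_measurable (K x).
Proof.
by split=> //; exists B => y; have /andP[h1 h2] := K_bounds x y; rewrite ger0_norm.
Qed.

Let eigenE x :
  (\int[mu]_(y in `[0%R, a]) (K x y * h y)%:E = (l * h x)%:E)%E.
Proof.
rewrite -h_eigen /Rintegral fineK//; apply: integrable_fin_num => //.
by apply: bounded_measurable_integrable; exact: bounded_measurableM.
Qed.

Let h_gt0 x : 0 < h x. Proof. exact: lt_le_trans (h_ge x). Qed.

Section L2_eigenfunction.
Context (g : R -> R) (l' : R).
Hypotheses (g_meas : measurable_fun D g)
  (g_L2 : (\int[mu]_(x in D) ((g x) ^+ 2)%:E < +oo)%E)
  (g_eigen : {ae mu, forall x, x \in `[0, a] ->
    (\int[mu]_(y in D) (Kx x y * (g y)%:E) = (l' * g x)%:E)%E})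
  (l_lt : l < l').

Let l'_gt0 : 0 < l'. Proof. exact: lt_trans l_lt. Qed.

Let mKg x : measurable_fun D (fun y => (K x y * `|g y|)%:E).
Proof.
apply/measurable_EFinP; apply: measurable_funM; last exact: measurableT_comp.
exact: measurable_funTS.
Qed.

(** Taking absolute values in the eigenvalue equation, with [K >= 0] and [l' > 0], makes [|g|] a
    subsolution. *)
Let dominated : {ae mu, forall x, x \in `[0, a] ->
  ((l' * `|g x|)%:E <= \int[mu]_(y in D) (K x y * `|g y|)%:E)%E}.
Proof.
apply: ae_imply g_eigen => x gx xa; have {}gx := gx xa.
have -> : (l' * `|g x|)%:E = `|(l' * g x)%:E|%E.
  by rewrite abse_EFin normrM (gtr0_norm l'_gt0).
have <- : (\int[mu]_(y in D) (K x y * g y)%:E = (l' * g x)%:E)%E.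
  by rewrite -gx; apply: eq_integral => y; rewrite inE => ya; rewrite KxE.
apply: le_trans (le_abse_integral _ _ _) _ => //.
  apply/measurable_EFinP; apply: measurable_funM => //.
  exact: (measurable_funTS (K_meas x)).
rewrite le_eqVlt; apply/orP; left; apply/eqP; apply: eq_integral => y _.
by have /andP[h1 _] := K_bounds x y; rewrite /= normrM (ger0_norm h1).
Qed.

(** One application of [dominated], followed by the eigenvalue equation of [h], turns the factor [t]
    into [t * (l / l')]. *)
Let contract t : 0 <= t ->
  {ae mu, forall x, x \in `[0, a] -> `|g x| <= t * h x} ->
  {ae mu, forall x, x \in `[0, a] -> `|g x| <= t * (l / l') * h x}.
Proof.
move=> t0 gt; apply: ae_imply dominated => x dom xa; have {}dom := dom xa.
have : (\int[mu]_(y in D) (K x y * `|g y|)%:E <= (t * (l * h x))%:E)%E.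
  have K0 y : 0 <= K x y by have /andP[] := K_bounds x y.
  have mKh : measurable_fun D (fun y => (K x y * h y)%:E).
    apply/measurable_EFinP; apply: measurable_funTS.
    by have [] := bounded_measurableM (bmK x) h_bm.
  have Kh0 y : D y -> (0 <= (K x y * h y)%:E)%E.
    by move=> _; rewrite lee_fin mulr_ge0// ltW.
  rewrite EFinM -eigenE -ge0_integralZl_EFin//.
  apply: ae_ge0_le_integral => //.
  - by move=> y _; rewrite lee_fin mulr_ge0.
  - exact: mKg.
  - by move=> y ya; apply: mule_ge0 (Kh0 y ya); rewrite lee_fin.
  - exact: measurable_funeM.
  - apply: ae_imply gt => y gy ya; rewrite -EFinM lee_fin mulrCA.
    by rewrite ler_wpM2l ?gy.
move=> /(le_trans dom); rewrite lee_fin => H.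
rewrite -(ler_pM2l l'_gt0); apply: le_trans H _.
rewrite le_eqVlt; apply/orP; left; apply/eqP.
by field; rewrite gt_eqF.
Qed.

(** On an interval of finite length, [|g| <= 1 + g ^+ 2] suffices. *)
Let g_L1 : (\int[mu]_(x in D) `|g x|%:E < +oo)%E.
Proof.
have mD : (mu D < +oo)%E.
  by rewrite /= lebesgue_measure_itv/= lte_fin a_gt0 sube0 ltry.
apply: (@le_lt_trans _ _ (\int[mu]_(x in D) (1%:E + ((g x) ^+ 2)%:E)%E)%E).
  apply: ge0_le_integral => //.
  - by apply/measurable_EFinP; exact: measurableT_comp.
  - apply: emeasurable_funD => //; apply/measurable_EFinP.
    exact: measurable_funX.
  - move=> x _; rewrite -EFinD lee_fin -[g x ^+ 2]real_normK ?num_real//.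
    have := sqr_ge0 (`|g x| - 1); have := normr_ge0 (g x).
    rewrite sqrrB1; lra.
rewrite ge0_integralD//; last 2 first.
- by move=> x _; rewrite lee_fin sqr_ge0.
- by apply/measurable_EFinP; exact: measurable_funX.
by rewrite integral_cst// mul1e lte_add_pinfty.
Qed.

(** One application of the bounded kernel turns the L1 norm into an a.e. bound, and [h >= q] turns
    that into a multiple of [h]; this starts the iteration. *)
Let bounded : exists2 t, 0 <= t &
  {ae mu, forall x, x \in `[0, a] -> `|g x| <= t * h x}.
Proof.
have fin : (\int[mu]_(x in D) `|g x|%:E)%E \is a fin_num.
  by rewrite ge0_fin_numE// integral_ge0.
pose G := fine (\int[mu]_(x in D) `|g x|%:E)%E.
have GE : (\int[mu]_(x in D) `|g x|%:E)%E = G%:E by rewrite /G fineK.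
have G0 : 0 <= G by rewrite fine_ge0// integral_ge0.
have B0 : 0 <= B by have /andP[] := K_bounds 0 0; exact: le_trans.
exists (B * G / l' / q).
  by rewrite !divr_ge0 ?mulr_ge0 ?(ltW l'_gt0) ?(ltW q_gt0).
apply: ae_imply dominated => x dom xa; have {}dom := dom xa.
have : (\int[mu]_(y in D) (K x y * `|g y|)%:E <= (B * G)%:E)%E.
  rewrite EFinM -GE -ge0_integralZl_EFin//; last first.
    by apply/measurable_EFinP; exact: measurableT_comp.
  apply: ge0_le_integral => //.
  - by move=> y _; rewrite lee_fin mulr_ge0//; have /andP[] := K_bounds x y.
  - exact: mKg.
  - apply: measurable_funeM.
    by apply/measurable_EFinP; exact: measurableT_comp.
  - move=> y _; rewrite -EFinM lee_fin ler_wpM2r//.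
    by have /andP[] := K_bounds x y.
move=> /(le_trans dom); rewrite lee_fin mulrC -ler_pdivlMr// => H.
apply: le_trans H _; rewrite -[leRHS]mulrA ler_peMr//.
  by rewrite divr_ge0 ?mulr_ge0 ?(ltW l'_gt0).
by rewrite mulrC ler_pdivlMr// mul1r.
Qed.

(* If l < l', a bound |g| <= t h a.e. improves itself to |g| <= t (l / l') h a.e. *)
Lemma L2_eigenfunction_ae_eq0 :
  {ae mu, forall x, x \in `[0, a] -> g x = 0}.
Proof.
have [t t0 gt] := bounded.
have ll' : 0 <= l / l' < 1.
  by rewrite divr_ge0 ?(ltW l_gt0) ?(ltW l'_gt0)//= ltr_pdivrMr ?mul1r.
have geo n : {ae mu, forall x, x \in `[0, a] ->
    `|g x| <= t * (l / l') ^+ n * h x}.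
  elim: n => [|n ih]; first by rewrite expr0 mulr1.
  have tn : 0 <= t * (l / l') ^+ n.
    by rewrite mulr_ge0// exprn_ge0//; case/andP: ll'.
  by apply: ae_imply (contract tn ih) => x; rewrite exprSr [t * (_ * _)]mulrA.
apply: ae_imply (ae_foralln geo) => x gx xa.
apply/eqP; rewrite -normr_le0.
apply: (@le0_of_le_geometric _ _ (t * h x) _ ll') => n.
by rewrite mulrAC; exact: gx.
Qed.

End L2_eigenfunction.

Lemma principal_eigenvalue_of_eigenfunction : principal_eigenvalue a Kx l.
Proof.
split.
  exists h; split => //.
  - exact: continuous_subspaceT.
  - move=> x xa; rewrite -eigenE; apply: eq_integral => y; rewrite inE => ya.
    by rewrite KxE.
move=> l' [g [mg g2 gn0 ge]]; rewrite leNgt; apply/negP => ll'.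
by apply: gn0; exact: L2_eigenfunction_ae_eq0 ge ll'.
Qed.

End principal_eigenvalue_of_positive_kernel.

Lemma principal_eigenvalue_exists (R : realType) (a m B L : R)
    (K : R -> R -> R) (Kx : R -> R -> \bar R) :
  0 < a -> 0 < m -> (forall x y, m <= K x y <= B) ->
  (forall x x' y, `|K x y - K x' y| <= L * `|x - x'|) ->
  (forall x, measurable_fun [set: R] (K x)) ->
  (B ^+ 2 - m ^+ 2) / (m ^+ 2 * (m / B)) < 1 ->
  (forall x y, x \in `[0, a] -> y \in `[0, a] -> Kx x y = (K x y)%:E) ->
  exists l, principal_eigenvalue a Kx l.
Proof.
move=> a0 m0 Kb Kl Km th KxE.
have [h [hc hb hq T0 Th]] := perron_eigenfunction a0 m0 Kb Kl Km th.
eexists.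
apply: (principal_eigenvalue_of_eigenfunction (B := B) a0 _ Km KxE hc _ hq hb
  T0 Th).
  by move=> x y; have /andP[h1 h2] := Kb x y; rewrite h2 andbT (le_trans (ltW m0)).
by have /andP[h1 h2] := Kb 0 0; rewrite divr_gt0// (lt_le_trans m0)// (le_trans h1).
Qed.

(** * Row-sum bounds on the principal eigenvalue *)

Section eigenvalue_bounds.
Context (R : realType) (a : R) (K : R -> R -> R) (Kx : R -> R -> \bar R) (l : R).
Notation mu := (@lebesgue_measure R).
Hypotheses (a_gt0 : 0 < a)
  (K_bm : forall x, bounded_measurable (K x))
  (K_ge0 : forall x y, 0 <= K x y)
  (KxE : forall x y, x \in `[0, a] -> y \in `[0, a] -> Kx x y = (K x y)%:E)
  (l_eigen : principal_eigenvalue a Kx l).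

(** The eigenvalue equation is read where the positive eigenfunction is minimal ([x1]) and maximal
    ([x2]), with [h y] under the integral replaced by that extremal value. *)
Lemma eigenvalue_between_row_sums : exists x1 x2, [/\ x1 \in `[0, a], x2 \in `[0, a],
  \int[mu]_(y in `[0, a]) K x1 y <= l & l <= \int[mu]_(y in `[0, a]) K x2 y].
Proof.
case: l_eigen => -[h [hc h0 hE]] _.
have a0 := ltW a_gt0.
have [x1 x1a hmin] := EVT_min a0 hc; have [x2 x2a hmax] := EVT_max a0 hc.
have mh : measurable_fun `[0, a] (EFin \o h).
  apply/measurable_EFinP; apply: subspace_continuous_measurable_fun => //.
have eqn x : x \in `[0, a] ->
    (\int[mu]_(y in `[0%R, a]) (K x y * h y)%:E = (l * h x)%:E)%E.
  move=> xa; rewrite -hE//; apply: eq_integral => y; rewrite inE => ya.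
  by rewrite KxE.
have KS x : (\int[mu]_(y in `[0%R, a]) (K x y)%:E =
    (\int[mu]_(y in `[0, a]) K x y)%:E)%E.
  rewrite /Rintegral fineK//; apply: integrable_fin_num => //.
  exact: bounded_measurable_integrable.
have mK x : measurable_fun `[0, a] (fun y => (K x y)%:E).
  apply/measurable_EFinP; apply: measurable_funTS.
  by have [] := K_bm x.
have mKh x : measurable_fun `[0, a] (fun y => (K x y * h y)%:E).
  apply/measurable_EFinP; apply: measurable_funM; last exact/measurable_EFinP.
  by apply: measurable_funTS; have [] := K_bm x.
have SZ x c : 0 <= c -> (\int[mu]_(y in `[0%R, a]) (c%:E * (K x y)%:E) =
    (\int[mu]_(y in `[0, a]) K x y * c)%:E)%E.
  move=> c0; rewrite ge0_integralZl_EFin//.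
  - by rewrite KS -EFinM mulrC.
  - by move=> y _; rewrite lee_fin.
  - exact: mK.
have p1 := ltW (h0 _ x1a); have p2 := ltW (h0 _ x2a).
have hh y : y \in `[0, a] -> 0 <= h y by move=> /h0/ltW.
exists x1, x2; split => //.
  rewrite -(ler_pM2r (h0 _ x1a)) -lee_fin -(SZ _ _ p1) -(eqn _ x1a).
  apply: ge0_le_integral => //.
  - by move=> y ya; rewrite -EFinM lee_fin mulr_ge0.
  - by apply: measurable_funeM; exact: mK.
  - exact: mKh.
  - by move=> y ya; rewrite -EFinM lee_fin mulrC ler_wpM2l// hmin.
rewrite -(ler_pM2r (h0 _ x2a)) -lee_fin -(SZ _ _ p2) -(eqn _ x2a).
apply: ge0_le_integral => //.
- by move=> y ya; rewrite lee_fin mulr_ge0// hh.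
- exact: mKh.
- by apply: measurable_funeM; exact: mK.
- by move=> y ya; rewrite -EFinM lee_fin mulrC ler_wpM2r// hmax.
Qed.

End eigenvalue_bounds.

(** * The walk killed outside the positive half-line *)

Section translation.
Context (R : realType).
Notation mu := (@lebesgue_measure R).

Lemma lebesgue_measure_translation (a : R) (A : set R) : measurable A ->
  pushforward mu (fun s : R => s - a : measurableTypeR R) A = mu A.
Proof.
move=> mA.
have mt : measurable_fun [set: measurableTypeR R]
    (fun s => s - a : measurableTypeR R).
  exact: measurable_funB.
apply/esym/lebesgue_measure_unique => //= _ [[b c]] _ <-.
rewrite /pushforward.
have -> : (fun s : R => s - a) @^-1` `]b, c]%classic = `]b + a, c + a]%classic.
  apply/seteqP; split => x /=; rewrite !in_itv/=.
    by rewrite ltrBrDr lerBlDr.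
  by rewrite ltrBrDr lerBlDr.
rewrite !lebesgue_measure_itv/= !lte_fin ltrD2r.
by case: ifP => // _; congr (_%:E); ring.
Qed.

Lemma ge0_integral_translation (a : R) (D : set R) (f : R -> \bar R) :
  measurable D -> measurable_fun [set: R] f -> (forall x, (0 <= f x)%E) ->
  (\int[mu]_(s in (fun s => s - a)%R @^-1` D) f (s - a)%R =
   \int[mu]_(s in D) f s)%E.
Proof.
move=> mD mf f0.
have mt : measurable_fun [set: measurableTypeR R]
    (fun s => s - a : measurableTypeR R).
  exact: measurable_funB.
have := ge0_integral_pushforward mt (@lebesgue_measure R) mD
  (measurable_funTS mf) (fun x _ => f0 x).
rewrite /comp => <-.
apply: eq_measure_integral => //= A mA _.
exact: lebesgue_measure_translation.
Qed.

Lemma ge0_integral_opp (f : R -> \bar R) :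
  measurable_fun [set: R] f -> (forall x, (0 <= f x)%E) ->
  (\int[mu]_s f (- s)%R = \int[mu]_s f s)%E.
Proof.
move=> mf f0.
have mt : measurable_fun [set: measurableTypeR R] (-%R : _ -> measurableTypeR R).
  exact: oppr_measurable.
have := ge0_integral_pushforward mt (@lebesgue_measure R) measurableT
  mf (fun x _ => f0 x).
rewrite /comp => <-.
by apply: eq_measure_integral => //= A mA _; exact: lebesgue_measureN.
Qed.

End translation.

(** * Killed walk and its Green operator *)

Section killed_walk.
Context (R : realType) (rho : R -> R) (C D : R).
Hypothesis rd : regular_density rho C D.
Notation mu := (@lebesgue_measure R).
Local Notation Pos := (`]0%R, +oo[%classic : set R).

(** One step of the walk, counted only when it lands in (0, oo). The starting point may be
    nonpositive, as are the points of the translated strip. *)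
Definition killed (phi : R -> \bar R) (x : R) : \bar R :=
  (\int[mu]_(s in `]0%R, +oo[) ((rho (s - x))%:E * phi s))%E.

(** Summing in [\bar R] defines the Green operator before its finiteness is known. *)
Definition green (phi : R -> \bar R) (x : R) : \bar R :=
  (\sum_(m <oo) iter m killed phi x)%E.

Definition ge0_measurable (phi : R -> \bar R) :=
  measurable_fun [set: R] phi /\ forall x, (0 <= phi x)%E.

Let rho_ge0 x : 0 <= rho x. Proof. exact/ltW/(rd_gt0 rd). Qed.

Lemma density_abs x : rho x = rho `|x|.
Proof.
by have [x0|x0] := ger0P x; rewrite ?(rd_even rd).
Qed.

Lemma density_lipschitz (x y : R) : `|rho x - rho y| <= C * `|x - y|.
Proof.
rewrite (density_abs x) (density_abs y).
have := rd_lip rd (lexx 0) (normr_ge0 x) (normr_ge0 y).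
rewrite oppr0 expR0 mulr1 => /le_trans; apply.
by rewrite ler_wpM2l ?(ltW (rd_C_gt0 rd))// ler_dist_dist.
Qed.

Let mrho : measurable_fun [set: R] rho.
Proof.
apply: continuous_measurable_fun; exact: lipschitz_continuous density_lipschitz.
Qed.

Let mrhoB x : measurable_fun [set: R] (fun s => (rho (s - x))%:E).
Proof.
apply/measurable_EFinP; apply: measurableT_comp => //.
exact: measurable_funB.
Qed.

Let mul_ge0 phi x s : ge0_measurable phi -> (0 <= (rho (s - x))%:E * phi s)%E.
Proof. by move=> [_ p0]; rewrite mule_ge0// lee_fin. Qed.

Let mul_meas phi x (E : set R) : ge0_measurable phi ->
  measurable_fun E (fun s => (rho (s - x))%:E * phi s)%E.
Proof.
by move=> [mp _]; apply: measurable_funTS; exact: emeasurable_funM.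
Qed.

(** Measurability in the starting point is part of Tonelli's theorem, once [phi] is extended by 0
    outside [Pos] so that the integrand is jointly measurable on the plane. *)
Lemma ge0_measurable_killed phi : ge0_measurable phi ->
  ge0_measurable (killed phi).
Proof.
move=> ph; have [mp p0] := ph; split; last first.
  by move=> x; apply: integral_ge0 => s _; exact: mul_ge0.
pose psi := (phi \_ Pos)%E.
have mpsi : measurable_fun [set: R] psi.
  by apply/(measurable_restrictT _ _).1 => //; exact: measurable_funTS.
have psi0 s : (0 <= psi s)%E by apply: erestrict_ge0 => t _; exact: p0.
pose f (z : R * R) := ((rho (z.2 - z.1))%:E * psi z.2)%E.
have mf : measurable_fun [set: R * R] f.
  apply: emeasurable_funM; last exact: measurableT_comp mpsi measurable_snd.
  apply/measurable_EFinP; apply: measurableT_comp => //.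
  by apply: measurable_funB; [exact: measurable_snd|exact: measurable_fst].
have f0 z : (0 <= f z)%E by rewrite mule_ge0// lee_fin.
have := measurable_fun_fubini_tonelli_F (m2 := @lebesgue_measure R) f mf f0.
congr measurable_fun; apply/funext => x; rewrite /fubini_F /killed.
rewrite [RHS]integral_mkcond; apply: eq_integral => s _.
by rewrite /f /psi /= !patchE; case: ifP => // _; rewrite mule0.
Qed.

Lemma ge0_measurable_iter_killed m phi : ge0_measurable phi ->
  ge0_measurable (iter m killed phi).
Proof. by move=> ph; elim: m => //= m; exact: ge0_measurable_killed. Qed.

Lemma ge0_measurable_green phi : ge0_measurable phi ->
  ge0_measurable (green phi).
Proof.
move=> ph; split; last first.
  move=> x; apply: nneseries_ge0 => m _ _.
  by have [] := ge0_measurable_iter_killed m ph.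
apply: ge0_emeasurable_sum => m *; have [] := ge0_measurable_iter_killed m ph => //.
Qed.

Lemma killed_le phi psi x : ge0_measurable phi -> ge0_measurable psi ->
  (forall s, 0 < s -> (phi s <= psi s)%E) -> (killed phi x <= killed psi x)%E.
Proof.
move=> ph ps le; apply: ge0_le_integral => //.
- by move=> s _; exact: mul_ge0.
- exact: mul_meas.
- exact: mul_meas.
- move=> s; rewrite /= in_itv/= andbT => s0.
  by rewrite lee_wpmul2l// ?lee_fin// le.
Qed.

Lemma killedD phi psi x : ge0_measurable phi -> ge0_measurable psi ->
  killed (fun s => phi s + psi s)%E x = (killed phi x + killed psi x)%E.
Proof.
move=> ph ps; rewrite /killed -ge0_integralD//.
- apply: eq_integral => s _; rewrite ge0_muleDr//; first by have [] := ph.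
  by have [] := ps.
- by move=> s _; exact: mul_ge0.
- exact: mul_meas.
- by move=> s _; exact: mul_ge0.
- exact: mul_meas.
Qed.

Lemma killedZ (c : R) phi x : 0 <= c -> ge0_measurable phi ->
  killed (fun s => c%:E * phi s)%E x = (c%:E * killed phi x)%E.
Proof.
move=> c0 ph; rewrite /killed -ge0_integralZl_EFin//.
- by apply: eq_integral => s _; rewrite muleCA.
- by move=> s _; exact: mul_ge0.
- exact: mul_meas.
Qed.

Lemma ge0_measurableD phi psi : ge0_measurable phi -> ge0_measurable psi ->
  ge0_measurable (fun s => phi s + psi s)%E.
Proof.
move=> [m1 p1] [m2 p2]; split; first exact: emeasurable_funD.
by move=> x; rewrite adde_ge0.
Qed.

Lemma ge0_measurableZ (c : R) phi : 0 <= c -> ge0_measurable phi ->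
  ge0_measurable (fun s => c%:E * phi s)%E.
Proof.
move=> c0 [m1 p1]; split; first exact: measurable_funeM.
by move=> x; rewrite mule_ge0.
Qed.

Lemma iter_killed_le m phi psi s : ge0_measurable phi -> ge0_measurable psi ->
  (forall s, 0 < s -> (phi s <= psi s)%E) -> 0 < s ->
  (iter m killed phi s <= iter m killed psi s)%E.
Proof.
move=> ph ps le; elim: m s => [|m ih] s s0; first exact: le.
by apply: killed_le => //; exact: ge0_measurable_iter_killed.
Qed.

Lemma iter_killedD m phi psi : ge0_measurable phi -> ge0_measurable psi ->
  iter m killed (fun s => phi s + psi s)%E =
  (fun s => iter m killed phi s + iter m killed psi s)%E.
Proof.
move=> ph ps; elim: m => //= m ->; apply/funext => x.
by rewrite killedD//; exact: ge0_measurable_iter_killed.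
Qed.

Lemma iter_killedZ m (c : R) phi : 0 <= c -> ge0_measurable phi ->
  iter m killed (fun s => c%:E * phi s)%E =
  (fun s => c%:E * iter m killed phi s)%E.
Proof.
move=> c0 ph; elim: m => //= m ->; apply/funext => x.
by rewrite killedZ//; exact: ge0_measurable_iter_killed.
Qed.

Let iter_ge0 m phi x : ge0_measurable phi -> (0 <= iter m killed phi x)%E.
Proof. by move=> ph; have [] := ge0_measurable_iter_killed m ph. Qed.

Lemma green_le phi psi s : ge0_measurable phi -> ge0_measurable psi ->
  (forall s, 0 < s -> (phi s <= psi s)%E) -> 0 < s ->
  (green phi s <= green psi s)%E.
Proof.
move=> ph ps le s0; apply: lee_nneseries => m *; first exact: iter_ge0.
exact: iter_killed_le.
Qed.

Lemma greenD phi psi s : ge0_measurable phi -> ge0_measurable psi ->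
  green (fun s => phi s + psi s)%E s = (green phi s + green psi s)%E.
Proof.
move=> ph ps; rewrite /green -nneseriesD//; last 2 first.
  by move=> *; exact: iter_ge0.
  by move=> *; exact: iter_ge0.
by apply: eq_eseriesr => m _; rewrite iter_killedD.
Qed.

Lemma greenZ (c : R) phi s : 0 <= c -> ge0_measurable phi ->
  green (fun s => c%:E * phi s)%E s = (c%:E * green phi s)%E.
Proof.
move=> c0 ph; rewrite /green -nneseriesZl//; last by move=> *; exact: iter_ge0.
by apply: eq_eseriesr => m _; rewrite iter_killedZ.
Qed.

Lemma killed_green phi x : ge0_measurable phi ->
  killed (green phi) x = (\sum_(m <oo) iter m.+1 killed phi x)%E.
Proof.
move=> ph; rewrite -integral_nneseries//.
- apply: eq_integral => s _; rewrite /green nneseriesZl// => *.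
  exact: iter_ge0.
- move=> m; apply: mul_meas; exact: ge0_measurable_iter_killed.
- by move=> m s _; apply: mul_ge0; exact: ge0_measurable_iter_killed.
Qed.

Lemma greenE phi x : ge0_measurable phi ->
  green phi x = (phi x + killed (green phi) x)%E.
Proof.
move=> ph; rewrite killed_green// /green nneseries_recl//; last first.
  by move=> *; exact: iter_ge0.
congr (_ + _)%E; rewrite -nneseries_addn; last by move=> *; exact: iter_ge0.
by apply: eq_eseriesr => m _; rewrite addn1.
Qed.

Let ge0_measurable_rho y : ge0_measurable (fun s => (rho (y - s))%:E).
Proof.
split=> [|x]; last by rewrite lee_fin.
by apply/measurable_EFinP; apply: measurableT_comp => //; exact: measurable_funB.
Qed.

(** Subtracting [a] turns the constraint to (a, oo) into one to (0, oo). A path of [m.+1] steps has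
    [m] constrained intermediate points, hence [iter m]. *)
Lemma walk_kernel_killed (a : R) m x y : walk_kernel rho a m.+1 x y =
  iter m killed (fun s => (rho (y - a - s))%:E) (x - a).
Proof.
elim: m x => [|m ih] x; first by rewrite /= (_ : y - a - (x - a) = y - x) //; ring.
have -> : walk_kernel rho a m.+2 x y =
    (\int[mu]_(s in `]a, +oo[)
      ((rho (s - x))%:E * walk_kernel rho a m.+1 s y))%E by [].
pose H r := ((rho (r - (x - a)))%:E *
  iter m killed (fun s => (rho (y - a - s))%:E) r)%E.
have gi := ge0_measurable_iter_killed m (ge0_measurable_rho (y - a)).
transitivity (\int[mu]_(s in `]a, +oo[) H (s - a)%R)%E.
  by apply: eq_integral => s _; rewrite ih /H (_ : s - a - (x - a) = s - x) //; ring.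
have -> : `]a, +oo[%classic = (fun s => s - a) @^-1` `]0, +oo[%classic.
  by apply/seteqP; split=> s /=; rewrite !in_itv/= !andbT subr_gt0.
rewrite ge0_integral_translation//; first exact: mul_meas.
by move=> r; exact: mul_ge0.
Qed.

(** The one-step term is split off: it carries the quadratic dependence on [y - x], while the
    remainder depends on [x - a] and [y - a] only. *)
Lemma sum_kernel_green (a x y : R) : sum_kernel rho a x y =
  ((rho (y - x))%:E + killed (green (fun s => (rho (y - a - s))%:E)) (x - a))%E.
Proof.
have gm := ge0_measurable_rho (y - a).
transitivity (green (fun s => (rho (y - a - s))%:E) (x - a)).
  rewrite /sum_kernel -nneseries_addn; last first.
    by case=> // m; rewrite walk_kernel_killed; exact: iter_ge0.
  by apply: eq_eseriesr => m _; rewrite addn1 walk_kernel_killed.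
by rewrite greenE// (_ : y - a - (x - a) = y - x) //; ring.
Qed.

(** * Barrier estimate for the Green operator *)

Let decay (s : R) : \bar R := (expR (- s))%:E.

(** Truncation at 4 makes [4 - trunc] a nonnegative barrier; on the positive half-line the
    truncation is inactive. *)
Let trunc (t : R) : R := Num.min (expR (- t)) 4.

(** Half of the gain that the interval [1, 2], of length 1, brings to the symmetrised mean. *)
Let eta : R := expR (- 2) * rho 2 / 2.

Let eta_gt0 : 0 < eta.
Proof. by rewrite divr_gt0// mulr_gt0 ?expR_gt0// (rd_gt0 rd). Qed.

Let trunc_bounds t : 0 <= trunc t <= 4.
Proof. by rewrite le_min expR_ge0 ler0n ge_min lexx orbT. Qed.

Let mtrunc : measurable_fun [set: R] trunc.
Proof.
by apply: measurable_minr => //; apply: measurableT_comp => //.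
Qed.

Let ge0_measurable_decay : ge0_measurable decay.
Proof.
split=> [|x]; last by rewrite lee_fin expR_ge0.
by apply/measurable_EFinP; apply: measurableT_comp.
Qed.

(* Symmetrised, min(e^{-t}, 4) dominates 2 everywhere, and strictly so on [1, 2]:
   this is where the gain eta comes from. *)
Let trunc_symmetric t :
  2 + expR (- 2) * \1_(`[1, 2]%classic : set R) t <= trunc t + trunc (- t).
Proof.
have mult : expR (- t) * expR t = 1 by rewrite -expRD addNr expR0.
have p := expR_gt0 t; have n := expR_gt0 (- t).
have amgm : 2 <= expR (- t) + expR t.
  by have := sqr_ge0 (expR (- t) - expR t); rewrite sqrrB mult; nra.
have base : 2 <= trunc t + trunc (- t).
  by rewrite /trunc opprK; case: (leP (expR (- t)) 4) => h1;
    case: (leP (expR t) 4) => h2; lra.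
rewrite indicE; case: (boolP (t \in _)) => [|_]; last by rewrite mulr0 addr0.
rewrite inE/= in_itv/= => /andP[t1 t2]; rewrite mulr1.
have e2 : 2 <= expR t.
  by apply: le_trans (expR_ge1Dx t); lra.
have e1 : expR (- t) <= 1 by rewrite expR_le1; lra.
have em : expR (- 2) <= expR (- t) by rewrite ler_expR; lra.
by rewrite /trunc opprK; case: (leP (expR (- t)) 4) => h1;
    case: (leP (expR t) 4) => h2; lra.
Qed.

(** [trunc_symmetric] is integrated against [rho]: total mass 1 gives the 2, and [rho >= rho 2] on
    [1, 2] gives [2 * eta]. *)
Let mass_indic :
  ((2 + 2 * eta)%:E <= \int[mu]_t (rho t * (trunc t + trunc (- t)))%:E)%E.
Proof.
have i1 : (\int[mu]_t (2%:E * (rho t)%:E) = 2%:E)%E.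
  rewrite ge0_integralZl_EFin ?(rd_mass rd) ?mule1//; last exact/measurable_EFinP.
  by move=> t _; rewrite lee_fin.
pose k := expR (- 2) * rho 2.
have k0 : 0 <= k by rewrite mulr_ge0 ?expR_ge0.
have mi : measurable_fun [set: R]
    (fun t => (\1_(`[1, 2]%classic : set R) t)%:E : \bar R).
  by apply/measurable_EFinP; exact: measurable_indic.
have i2 : (\int[mu]_t (k%:E * (\1_(`[1, 2]%classic : set R) t)%:E) = k%:E)%E.
  rewrite ge0_integralZl_EFin// integral_indic// setIT/=.
  rewrite lebesgue_measure_itv/= lte_fin ltr1n/=.
  by rewrite -EFinB -EFinM; congr (_%:E); ring.
have -> : (2 + 2 * eta)%:E = (2%:E + k%:E)%E.
  by rewrite -EFinD; congr (_%:E); rewrite /eta /k; field.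
rewrite -i1 -i2 -ge0_integralD//; last 4 first.
- by move=> t _; rewrite -EFinM lee_fin mulr_ge0.
- by apply: measurable_funeM; exact/measurable_EFinP.
- by move=> t _; rewrite -EFinM lee_fin mulr_ge0// indicE.
- exact: measurable_funeM.
apply: ge0_le_integral => //.
- by move=> t _; rewrite -!EFinM -EFinD lee_fin addr_ge0// mulr_ge0// indicE.
- apply: emeasurable_funD; apply: measurable_funeM => //.
  exact/measurable_EFinP.
- apply/measurable_EFinP; apply: measurable_funM => //.
  by apply: measurable_funD => //; apply: measurableT_comp.
- move=> t _; rewrite -!EFinM -EFinD lee_fin.
  have := ler_wpM2l (rho_ge0 t) (trunc_symmetric t); apply: le_trans.
  rewrite mulrDr mulrC lerD2l /k indicE.
  case: (boolP (t \in _)) => [|_]; last by rewrite !mulr0.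
  rewrite inE/= in_itv/= => /andP[t1 t2]; rewrite !mulr1 mulrC.
  rewrite ler_wpM2r ?expR_ge0// (rd_decr rd)//.
  by rewrite (le_trans _ t1).
Qed.

Let half_bound (r : R) (I : \bar R) :
  ((2 + 2 * r)%:E <= I + I)%E -> ((1 + r)%:E <= I)%E.
Proof.
by case: I => [I| |]//; rewrite ?leey// -EFinD !lee_fin; lra.
Qed.

(** By symmetry of [rho], the integrals of [trunc t] and [trunc (- t)] agree, so each is half of the
    symmetrised one. *)
Let mass_trunc :
  ((1 + eta)%:E <= \int[mu]_t (rho t * trunc t)%:E)%E.
Proof.
have m1 : measurable_fun [set: R] (fun t => (rho t * trunc t)%:E).
  by apply/measurable_EFinP; exact: measurable_funM.
have p1 t : (0 <= (rho t * trunc t)%:E)%E.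
  by rewrite lee_fin mulr_ge0//; have /andP[] := trunc_bounds t.
have m2 : measurable_fun [set: R] (fun t => (rho t * trunc (- t))%:E).
  apply/measurable_EFinP; apply: measurable_funM => //.
  exact: measurableT_comp.
have p2 t : (0 <= (rho t * trunc (- t))%:E)%E.
  by rewrite lee_fin mulr_ge0//; have /andP[] := trunc_bounds (- t).
have sym : (\int[mu]_t (rho t * trunc (- t))%:E =
            \int[mu]_t (rho t * trunc t)%:E)%E.
  rewrite -[RHS](ge0_integral_opp m1 p1).
  by apply: eq_integral => t _; rewrite (rd_even rd).
have := mass_indic.
rewrite (_ : \int[mu]_t _ = (\int[mu]_t (rho t * trunc t)%:E +
    \int[mu]_t (rho t * trunc (- t))%:E))%E; last first.
  rewrite -ge0_integralD//.
  by apply: eq_integral => t _; rewrite -EFinD mulrDr.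
rewrite sym; exact: half_bound.
Qed.

Let barrier (s : R) : \bar R := (4 - trunc s)%:E.

Let ge0_measurable_barrier : ge0_measurable barrier.
Proof.
split=> [|x]; last by rewrite lee_fin subr_ge0; have /andP[] := trunc_bounds x.
by apply/measurable_EFinP; exact: measurable_funB.
Qed.

Let ge0_measurable_cst (k : R) : 0 <= k -> ge0_measurable (fun=> k%:E).
Proof. by move=> k0; split=> [|x]; [exact: measurable_cst|rewrite lee_fin]. Qed.

Lemma killed_le_line phi x : ge0_measurable phi ->
  (killed phi x <= \int[mu]_t ((rho t)%:E * phi (t + x)%R))%E.
Proof.
move=> ph; pose f r := ((rho r)%:E * phi (r + x)%R)%E.
have mf : measurable_fun [set: R] f.
  apply: emeasurable_funM; first exact/measurable_EFinP.
  by apply: measurableT_comp; [have [] := ph|exact: measurable_funD].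
have f0 r : (0 <= f r)%E by rewrite mule_ge0 ?lee_fin//; have [] := ph.
rewrite -/f -(ge0_integral_translation x measurableT mf f0) preimage_setT.
apply: (@le_trans _ _ (\int[mu]_s ((rho (s - x))%:E * phi s))%E).
  by apply: ge0_subset_integral => // [|s _]; [exact: mul_meas|exact: mul_ge0].
rewrite le_eqVlt; apply/orP; left; apply/eqP.
by apply: eq_integral => s _; rewrite /f subrK.
Qed.

Lemma killed_cst_le (k : R) x : 0 <= k -> (killed (fun=> k%:E) x <= k%:E)%E.
Proof.
move=> k0; apply: le_trans (killed_le_line _ (ge0_measurable_cst k0)) _.
rewrite ge0_integralZr//; last 2 first.
- exact/measurable_EFinP.
- by move=> t _; rewrite lee_fin.
by rewrite (rd_mass rd) mul1e.
Qed.

(** Elimination of the mean [I], done in [\bar R] so that [I] may be infinite. In the application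
    [e] is [expR (- x)], [r] is the height 4 and [F] bounds the killed barrier [b]. *)
Let affine_bound (e r : R) (b F I : \bar R) : 0 < e ->
  (F + e%:E * I = r%:E)%E -> (b <= F)%E -> ((1 + eta)%:E <= I)%E ->
  (b + eta%:E * e%:E <= (r - e)%:E)%E.
Proof.
move=> e0; case: I => [I| |] //; last first.
  by rewrite mulry gtr0_sg// mul1e; case: F.
case: F => [F| |]//; rewrite -EFinM => -[<-].
case: b => [b| |]//; last by move=> _ _; exact: leNye.
rewrite !lee_fin => bF h.
have := ler_wpM2l (ltW e0) h; lra.
Qed.

(* Uses min(e^{-(t+x)}, 4) >= e^{-x} min(e^{-t}, 4) for x > 0, and that the mean of
   min(e^{-t}, 4) under rho is at least 1 + eta. *)
Let barrier_supersolution x : 0 < x ->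
  (killed barrier x + eta%:E * decay x <= barrier x)%E.
Proof.
move=> x0; have ex1 : expR (- x) <= 1 by rewrite expR_le1 oppr_le0 ltW.
have tx : trunc x = expR (- x).
  by rewrite /trunc min_l//; lra.
have ex0 := expR_ge0 (- x).
pose F := (\int[mu]_t (rho t * (4 - expR (- x) * trunc t))%:E)%E.
have m1 : measurable_fun [set: R] (fun t => (rho t * trunc t)%:E).
  by apply/measurable_EFinP; exact: measurable_funM.
have p1 t : (0 <= (rho t * trunc t)%:E)%E.
  by rewrite lee_fin mulr_ge0//; have /andP[] := trunc_bounds t.
have F_int : (F + (expR (- x))%:E * \int[mu]_t (rho t * trunc t)%:E = 4%:E)%E.
  rewrite -ge0_integralZl_EFin// /F -ge0_integralD//.
  - transitivity (\int[mu]_t (4%:E * (rho t)%:E))%E.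
      apply: eq_integral => t _; rewrite -EFinM -EFinD -EFinM.
      by congr (_%:E); ring.
    rewrite ge0_integralZl_EFin ?(rd_mass rd) ?mule1//.
    + by move=> t _; rewrite lee_fin.
    + exact/measurable_EFinP.
  - move=> t _; rewrite lee_fin mulr_ge0// subr_ge0.
    have /andP[a1 a2] := trunc_bounds t.
    by apply: le_trans a2; rewrite ler_piMl.
  - apply/measurable_EFinP; apply: measurable_funM => //.
    by apply: measurable_funB => //; exact: measurable_funM.
  - by move=> t _; rewrite mule_ge0// lee_fin.
  - exact: measurable_funeM.
have kF : (killed barrier x <= F)%E.
  apply: le_trans (killed_le_line _ ge0_measurable_barrier) _.
  apply: ge0_le_integral => //.
  - move=> t _; rewrite mule_ge0 ?lee_fin// subr_ge0.
    by have /andP[] := trunc_bounds (t + x).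
  - apply: emeasurable_funM; first exact/measurable_EFinP.
    apply: measurableT_comp; last exact: measurable_funD.
    by have [] := ge0_measurable_barrier.
  - apply/measurable_EFinP; apply: measurable_funM => //.
    by apply: measurable_funB => //; exact: measurable_funM.
  - move=> t _; rewrite -EFinM lee_fin ler_wpM2l// lerD2l lerN2.
    rewrite /trunc opprD expRD le_min mulrC; apply/andP; split.
      by rewrite ler_wpM2r// ge_min lexx.
    apply: (@le_trans _ _ (4 * expR (- x))); last by lra.
    by rewrite ler_wpM2r// ge_min lexx orbT.
rewrite /barrier tx; exact: affine_bound (expR_gt0 _) F_int kF mass_trunc.
Qed.

Let M := 4 / eta.

Let M_ge0 : 0 <= M. Proof. by rewrite divr_ge0// ltW. Qed.

(** Iterating the supersolution inequality telescopes: [eta] times any partial Green sum is at most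
    [barrier s], hence at most 4. *)
Let green_decay s : 0 < s -> (green decay s <= M%:E)%E.
Proof.
move=> s0; have gd := ge0_measurable_decay; have gb := ge0_measurable_barrier.
(* The second term is what is left of the barrier after [N] steps; being nonnegative, it is dropped
   at the end. *)
have claim N : (eta%:E * (\sum_(0 <= m < N) iter m killed decay s) +
    iter N killed barrier s <= barrier s)%E.
  elim: N => [|N ih]; first by rewrite big_geq// mule0 add0e.
  apply: le_trans ih; rewrite big_nat_recr//= ge0_muleDr//; last 2 first.
  - by apply: sume_ge0 => m _; exact: iter_ge0.
  - exact: iter_ge0.
  rewrite -addeA leeD2l//.
  have gk := ge0_measurable_killed gb.
  have gz := ge0_measurableZ (ltW eta_gt0) gd.
  have := @iter_killed_le N _ _ s (ge0_measurableD gk gz) gb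
    barrier_supersolution s0.
  by rewrite iter_killedD// iter_killedZ ?(ltW eta_gt0)// -iterSr addeC.
apply: lime_le; first by apply: is_cvg_nneseries => *; exact: iter_ge0.
apply: nearW => N; rewrite /M.
rewrite -(@lee_pmul2l _ eta%:E) ?lte_fin//.
rewrite -EFinM mulrC divfK ?gt_eqF//.
apply: le_trans (_ : barrier s <= _)%E; last first.
  by rewrite lee_fin gerBl; have /andP[] := trunc_bounds s.
by apply: le_trans (claim N); rewrite leeDl// iter_ge0.
Qed.

Let green_le_decay (k : R) phi s : 0 <= k -> ge0_measurable phi ->
  (forall s, 0 < s -> (phi s <= k%:E * decay s)%E) -> 0 < s ->
  (green phi s <= (k * M)%:E)%E.
Proof.
move=> k0 ph le s0; have gz := ge0_measurableZ k0 ge0_measurable_decay.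
apply: le_trans (green_le ph gz le s0) _.
rewrite greenZ// EFinM lee_wpmul2l ?lee_fin// green_decay//.
Qed.

Let decay_mass : (\int[mu]_(s in `]0%R, +oo[) decay s <= 1)%E.
Proof.
rewrite -(@integral_exponential_pdf R 1 ltr01) integral_mkcond.
apply: ge0_le_integral => //.
- by move=> s _; apply: erestrict_ge0 => t _; rewrite lee_fin expR_ge0.
- apply/(measurable_restrictT _ _).1 => //; apply: measurable_funTS.
  by have [] := ge0_measurable_decay.
- by apply/measurable_EFinP; exact: measurable_exponential_pdf.
move=> s _; rewrite patchE; case: ifPn => [|_]; last first.
  by rewrite lee_fin exponential_pdf_ge0.
rewrite inE/= in_itv/= andbT => s0.
by rewrite exponential_pdfE ?(ltW s0)// mul1r mulN1r.
Qed.

(** * Bounds and Lipschitz estimates for the resolvent *)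

Let rho_swap x s : rho (x - s) = rho (s - x).
Proof. by rewrite -(rd_even rd) opprB. Qed.

(** As [x] and [y] are nonpositive, [s - x] and [s - y] are at least [s], so the slope of [rho]
    between them is at most [C * expR (- s)]. *)
Let tail_lip s x y : 0 < s -> x <= 0 -> y <= 0 ->
  rho (s - x) <= rho (s - y) + C * `|x - y| * expR (- s).
Proof.
move=> s0 x0 y0; rewrite -lerBlDl.
have sx : s <= s - x by lra.
have sy : s <= s - y by lra.
have := rd_lip rd (ltW s0) sx sy.
rewrite (_ : s - x - (s - y) = - (x - y)); last by ring.
rewrite normrN => h; apply: le_trans (ler_norm _) _.
by apply: le_trans h _; rewrite mulrAC.
Qed.

Let C_ge0 : 0 <= C. Proof. exact/ltW/(rd_C_gt0 rd). Qed.

Local Notation target y := (fun s => (rho (y - s))%:E).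

Let green_target_le y s : y <= 0 -> 0 < s ->
  (green (target y) s <= (C * M)%:E)%E.
Proof.
move=> y0 s0; apply: green_le_decay => // t t0.
rewrite /decay -EFinM lee_fin rho_swap.
have ty : 0 <= t - y by lra.
apply: le_trans (rd_exp rd ty) _.
by rewrite ler_wpM2l// ler_expR; lra.
Qed.

Let resolvent_le x y : y <= 0 -> (killed (green (target y)) x <= (C * M)%:E)%E.
Proof.
move=> y0; have CM : 0 <= C * M by rewrite mulr_ge0.
apply: le_trans (killed_cst_le x CM).
apply: (killed_le x (ge0_measurable_green (ge0_measurable_rho y))
  (ge0_measurable_cst CM)) => s s0.
exact: green_target_le.
Qed.

Let resolvent_ge0 x y : (0 <= killed (green (target y)) x)%E.
Proof.
have [] // := ge0_measurable_killed (ge0_measurable_green (ge0_measurable_rho y)).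
Qed.

Let resolvent_fin x y : y <= 0 -> killed (green (target y)) x \is a fin_num.
Proof.
by move=> y0; rewrite ge0_fin_numE// (le_lt_trans (resolvent_le _ y0))// ltry.
Qed.

(** Moving the endpoint perturbs the target by at most a multiple of [decay], on which the Green
    operator is at most [M]; the outer killed step has mass at most 1. *)
Let resolvent_lip_end x y y' : y <= 0 -> y' <= 0 ->
  (killed (green (target y)) x <=
   killed (green (target y')) x + (C * M * `|y - y'|)%:E)%E.
Proof.
move=> y0 y'0.
have k0 : 0 <= C * `|y - y'| by rewrite mulr_ge0.
have kM0 : 0 <= C * M * `|y - y'| by apply: mulr_ge0 => //; exact: mulr_ge0.
have g1 := ge0_measurable_green (ge0_measurable_rho y).
have g2 := ge0_measurable_green (ge0_measurable_rho y').
have gc := ge0_measurable_cst kM0.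
apply: le_trans (_ : killed (fun s => green (target y') s +
    (C * M * `|y - y'|)%:E)%E x <= _)%E.
  apply: killed_le => //; first exact: ge0_measurableD.
  move=> s s0.
  have gz := ge0_measurableZ k0 ge0_measurable_decay.
  apply: le_trans (green_le (ge0_measurable_rho y)
    (ge0_measurableD (ge0_measurable_rho y') gz) _ s0) _.
    move=> t t0; rewrite /decay -EFinM -EFinD lee_fin (rho_swap y) (rho_swap y').
    exact: tail_lip.
  rewrite greenD// leeD2l// greenZ//.
  by rewrite mulrAC [leRHS]EFinM lee_wpmul2l ?lee_fin// green_decay.
by rewrite killedD// leeD2l// killed_cst_le.
Qed.

(** Moving the starting point perturbs the first step only. The change of its density is at most a
    multiple of [decay], of mass at most 1, and the Green factor is at most [C * M]. *)
Let resolvent_lip_start x x' y : x <= 0 -> x' <= 0 -> y <= 0 ->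
  (killed (green (target y)) x <=
   killed (green (target y)) x' + (C * (C * M) * `|x - x'|)%:E)%E.
Proof.
move=> x0 x'0 y0.
have g1 := ge0_measurable_green (ge0_measurable_rho y).
pose k := C * `|x - x'| * (C * M).
have k0 : 0 <= k by apply: mulr_ge0; exact: mulr_ge0.
have md : measurable_fun Pos decay.
  by apply: measurable_funTS; have [] := ge0_measurable_decay.
apply: (@le_trans _ _ (\int[mu]_(s in Pos)
    ((rho (s - x'))%:E * green (target y) s + k%:E * decay s))%E).
  apply: ge0_le_integral => //.
  - by move=> s _; exact: mul_ge0.
  - exact: mul_meas.
  - by apply: emeasurable_funD; [exact: mul_meas|exact: measurable_funeM].
  - move=> s; rewrite /= in_itv/= andbT => s0.
    have := green_target_le y0 s0; have := g1.2 s.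
    case: (green _ s) => [r| |]//; rewrite !lee_fin => r0 rC.
    rewrite /decay -?EFinM -?EFinD ?lee_fin.
    have := ler_wpM2r r0 (tail_lip s0 x0 x'0) => /le_trans; apply.
    rewrite mulrDl lerD2l /k [leRHS]mulrAC ler_wpM2l//.
    by rewrite !mulr_ge0// expR_ge0.
rewrite ge0_integralD//; last 4 first.
- by move=> s _; exact: mul_ge0.
- exact: mul_meas.
- by move=> s _; rewrite mule_ge0// lee_fin expR_ge0.
- exact: measurable_funeM.
rewrite leeD2l// ge0_integralZl_EFin//; last first.
  by move=> s _; rewrite lee_fin expR_ge0.
apply: (@le_trans _ _ (k%:E * 1)%E); first by rewrite lee_wpmul2l ?lee_fin.
by rewrite mule1 lee_fin /k mulrAC.
Qed.

(** Moving either endpoint from below up to 0 brings it closer to every [s > 0], which increases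
    [rho]. *)
Let resolvent_mono x y : x <= 0 -> y <= 0 ->
  (killed (green (target y)) x <= killed (green (target 0)) 0)%E.
Proof.
move=> x0 y0.
have g1 := ge0_measurable_green (ge0_measurable_rho y).
have g2 := ge0_measurable_green (ge0_measurable_rho 0).
apply: (@le_trans _ _ (killed (green (target 0)) x)).
  apply: killed_le => // s s0; apply: green_le => // t t0.
  rewrite lee_fin (rho_swap y) (rho_swap 0) (rd_decr rd)//; lra.
apply: ge0_le_integral => //.
- by move=> s _; exact: mul_ge0.
- exact: mul_meas.
- exact: mul_meas.
- move=> s; rewrite /= in_itv/= andbT => s0.
  rewrite lee_wpmul2r//; first by have [] := g2.
  rewrite lee_fin (rd_decr rd)//; lra.
Qed.

(** [L] and [k] are chosen before the width [a], so the deviation of the kernel from its value at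
    width 0 is controlled uniformly in [a]. *)
Lemma walk_resolvent : exists (L : R -> R -> R) (k : R), [/\ 0 <= k,
  (forall a x y, x <= a -> y <= a ->
    sum_kernel rho a x y = (rho (y - x) + L (x - a) (y - a))%:E),
  (forall x y, x <= 0 -> y <= 0 -> 0 <= L x y <= L 0 0),
  (forall x x' y, x <= 0 -> x' <= 0 -> y <= 0 ->
    `|L x y - L x' y| <= k * `|x - x'|) &
  (forall x y y', x <= 0 -> y <= 0 -> y' <= 0 ->
    `|L x y - L x y'| <= k * `|y - y'|)].
Proof.
pose L x y := fine (killed (green (target y)) x).
have LE x y : y <= 0 -> (killed (green (target y)) x = (L x y)%:E)%E.
  by move=> y0; rewrite /L fineK// resolvent_fin.
(* The Lipschitz constants in the endpoint and in the starting point. *)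
pose k := Num.max (C * M) (C * (C * M)).
exists L, k; split.
- by rewrite le_max mulr_ge0.
- move=> a x y xa ya; rewrite sum_kernel_green LE ?subr_le0//.
- move=> x y x0 y0; rewrite -!lee_fin -!LE//.
  by rewrite resolvent_ge0 resolvent_mono.
- move=> x x' y x0 x'0 y0.
  have step u v : u <= 0 -> v <= 0 -> L u y - L v y <= k * `|u - v|.
    move=> u0 v0; have := resolvent_lip_start u0 v0 y0.
    rewrite !LE// -EFinD lee_fin -lerBlDl => /le_trans; apply.
    by rewrite ler_wpM2r// le_max lexx orbT.
  by rewrite ler_norml lerNl opprB step// distrC step.
- move=> x y y' x0 y0 y'0.
  have step u v : u <= 0 -> v <= 0 -> L x u - L x v <= k * `|u - v|.
    move=> u0 v0; have := resolvent_lip_end x u0 v0.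
    rewrite !LE// -EFinD lee_fin -lerBlDl => /le_trans; apply.
    by rewrite ler_wpM2r// le_max lexx.
  by rewrite ler_norml lerNl opprB step// distrC step.
Qed.

End killed_walk.

(** * The strip *)

(* Clamping extends the strip kernel from [0, a]^2 to the plane, so that its
   bounds and Lipschitz estimates hold without membership conditions. *)
Definition clamp (R : realType) (a x : R) : R := Num.max 0 (Num.min x a).

Lemma clamp_bounds (R : realType) (a x : R) : 0 <= a -> 0 <= clamp a x <= a.
Proof. by move=> a0; rewrite le_max lexx/= ge_max a0 ge_min lexx orbT. Qed.

Lemma clamp_id (R : realType) (a x : R) : x \in `[0, a] -> clamp a x = x.
Proof.
by rewrite in_itv/= => /andP[x0 xa]; rewrite /clamp min_l// max_r.
Qed.

Lemma clamp_lipschitz (R : realType) (a x y : R) :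
  `|clamp a x - clamp a y| <= `|x - y|.
Proof.
wlog xy : x y / x <= y.
  move=> h; have [/h//|/ltW/h] := leP x y.
  by rewrite distrC (distrC y).
rewrite /clamp (distrC x) [leRHS]ger0_norm ?subr_ge0// distrC.
case: (leP x a) => xa; case: (leP y a) => ya;
  case: (leP 0 x) => x0; case: (leP 0 y) => y0; case: (leP 0 a) => a0;
  rewrite ger0_norm; lra.
Qed.

Section strip.
Context (R : realType) (rho : R -> R) (C D k : R) (L : R -> R -> R).
Notation mu := (@lebesgue_measure R).
Hypotheses (rd : regular_density rho C D) (k_ge0 : 0 <= k)
  (sum_kernelE : forall a x y, x <= a -> y <= a ->
    sum_kernel rho a x y = (rho (y - x) + L (x - a) (y - a))%:E)
  (L_bounds : forall x y, x <= 0 -> y <= 0 -> 0 <= L x y <= L 0 0)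
  (L_lip1 : forall x x' y, x <= 0 -> x' <= 0 -> y <= 0 ->
    `|L x y - L x' y| <= k * `|x - x'|)
  (L_lip2 : forall x y y', x <= 0 -> y <= 0 -> y' <= 0 ->
    `|L x y - L x y'| <= k * `|y - y'|).

Let B := rho 0 + L 0 0.
(** One [C] for the step density and one [k] for each argument of [L]. *)
Let c1 := C + 2 * k.

Let B_gt0 : 0 < B.
Proof.
have /andP[h _] := L_bounds (lexx 0) (lexx 0).
by rewrite ltr_wpDr// (rd_gt0 rd).
Qed.

Let c1_gt0 : 0 < c1.
Proof. by rewrite ltr_wpDr ?mulr_ge0// (rd_C_gt0 rd). Qed.

Lemma beta_cE : beta_c rho = - ln B.
Proof.
rewrite /beta_c -[X in fine X]/(sum_kernel rho 0 0 0) sum_kernelE//.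
by rewrite !subr0.
Qed.

(** * Kernel and eigenvalue at a fixed width *)

Section fixed_width.
Variable a : R.
Hypotheses (a_gt0 : 0 < a) (a_le1 : a <= 1) (a_small : 10 * c1 * a <= B).

Let a_ge0 : 0 <= a. Proof. exact: ltW. Qed.

Let K x y := rho (clamp a y - clamp a x) + L (clamp a x - a) (clamp a y - a).

Let cl0 x : 0 <= clamp a x. Proof. by have /andP[] := clamp_bounds x a_ge0. Qed.

Let cla x : clamp a x <= a. Proof. by have /andP[] := clamp_bounds x a_ge0. Qed.

Let clN x : clamp a x - a <= 0. Proof. by rewrite subr_le0. Qed.

Let dist_cl x y : `|clamp a y - clamp a x| <= a.
Proof.
rewrite ler_norml; have := cl0 x; have := cl0 y; have := cla x; have := cla y.
by move=> *; apply/andP; split; lra.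
Qed.

Let K_upper x y : K x y <= B - D * (clamp a y - clamp a x) ^+ 2.
Proof.
have h := rd_quad rd (le_trans (dist_cl x y) a_le1).
have /andP[_ h2] := L_bounds (clN x) (clN y).
rewrite /K /B; lra.
Qed.

(** The increment is moved to 0, then each argument of [L] in turn; every move has length at most
    [a]. *)
Let K_lower x y : B - c1 * a <= K x y.
Proof.
have h1 : rho 0 - rho (clamp a y - clamp a x) <= C * a.
  apply: le_trans (ler_norm _) _.
  apply: le_trans (density_lipschitz rd _ _) _.
  by rewrite sub0r normrN ler_wpM2l ?dist_cl// ltW// (rd_C_gt0 rd).
have cx z : `|0 - (clamp a z - a)| <= a.
  rewrite sub0r opprB ger0_norm ?subr_ge0// gerBl//.
have h2 : L 0 0 - L (clamp a x - a) 0 <= k * a.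
  apply: le_trans (ler_norm _) _; apply: le_trans (L_lip1 _ _ _) _ => //.
  by rewrite ler_wpM2l.
have h3 : L (clamp a x - a) 0 - L (clamp a x - a) (clamp a y - a) <= k * a.
  apply: le_trans (ler_norm _) _; apply: le_trans (L_lip2 _ _ _) _ => //.
  by rewrite ler_wpM2l.
rewrite /K /B /c1; lra.
Qed.

Let K_bounds x y : B - c1 * a <= K x y <= B.
Proof.
rewrite K_lower/=; apply: le_trans (K_upper x y) _.
by rewrite gerBl mulr_ge0 ?sqr_ge0// ltW// (rd_D_gt0 rd).
Qed.

Let K_lip1 x x' y : `|K x y - K x' y| <= (C + k) * `|x - x'|.
Proof.
have e : K x y - K x' y =
  (rho (clamp a y - clamp a x) - rho (clamp a y - clamp a x')) +
  (L (clamp a x - a) (clamp a y - a) - L (clamp a x' - a) (clamp a y - a)).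
  by rewrite /K; ring.
rewrite e (le_trans (ler_normD _ _))// mulrDl lerD//.
  apply: le_trans (density_lipschitz rd _ _) _.
  rewrite ler_wpM2l ?(ltW (rd_C_gt0 rd))//.
  rewrite (_ : _ - _ - (_ - _) = clamp a x' - clamp a x); last by ring.
  by rewrite distrC clamp_lipschitz.
apply: le_trans (L_lip1 _ _ _) _ => //.
rewrite ler_wpM2l// (_ : _ - a - (_ - a) = clamp a x - clamp a x'); last by ring.
exact: clamp_lipschitz.
Qed.

Let K_lip2 x y y' : `|K x y - K x y'| <= (C + k) * `|y - y'|.
Proof.
have e : K x y - K x y' =
  (rho (clamp a y - clamp a x) - rho (clamp a y' - clamp a x)) +
  (L (clamp a x - a) (clamp a y - a) - L (clamp a x - a) (clamp a y' - a)).
  by rewrite /K; ring.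
rewrite e (le_trans (ler_normD _ _))// mulrDl lerD//.
  apply: le_trans (density_lipschitz rd _ _) _.
  rewrite ler_wpM2l ?(ltW (rd_C_gt0 rd))//.
  rewrite (_ : _ - _ - (_ - _) = clamp a y - clamp a y'); last by ring.
  exact: clamp_lipschitz.
apply: le_trans (L_lip2 _ _ _) _ => //.
rewrite ler_wpM2l// (_ : _ - a - (_ - a) = clamp a y - clamp a y'); last by ring.
exact: clamp_lipschitz.
Qed.

Let K_meas x : measurable_fun [set: R] (K x).
Proof.
apply: continuous_measurable_fun; apply: (@lipschitz_continuous _ _ (C + k)).
exact: K_lip2.
Qed.

Let KE x y : x \in `[0, a] -> y \in `[0, a] ->
  sum_kernel rho a x y = (K x y)%:E.
Proof.
move=> xa ya; rewrite /K !clamp_id//; move: xa ya.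
by rewrite !in_itv/= => /andP[_ xa] /andP[_ ya]; rewrite sum_kernelE.
Qed.

Let m := B - c1 * a.

Let m_ge : 9 / 10 * B <= m.
Proof.
have : c1 * a <= B / 10 by rewrite ler_pdivlMr// mulrC mulrA.
by rewrite /m; move: (c1 * a) B => u v; lra.
Qed.

Let m_gt0 : 0 < m.
Proof. by apply: lt_le_trans m_ge; rewrite mulr_gt0. Qed.

Let delta := delta0 rho a.

(** Once existence is known, [delta0] selects a genuine principal eigenvalue and not the default
    0. *)
Let delta_principal : principal_eigenvalue a (sum_kernel rho a) delta.
Proof.
apply: (xgetPex 0).
apply: (principal_eigenvalue_exists a_gt0 m_gt0 K_bounds K_lip1 K_meas _ KE).
(* With [m >= 9 / 10 * B], the contraction factor is at most (1 - 0.81) / (0.81 * 0.9), about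
   0.26. *)
have m2 : (9 / 10 * B) ^+ 2 <= m ^+ 2.
  by rewrite lerXn2r// ?nnegrE ?mulr_ge0// ltW.
have B2 : 0 < B ^+ 2 by rewrite exprn_gt0.
have mB : 9 / 10 <= m / B by rewrite ler_pdivlMr.
rewrite ltr_pdivrMr ?mul1r; last by rewrite mulr_gt0 ?exprn_gt0// divr_gt0.
apply: (@lt_le_trans _ _ ((9 / 10 * B) ^+ 2 * (9 / 10))); last first.
  by apply: ler_pM => //; rewrite sqr_ge0.
have gen (b u : R) : 0 < b -> (9 / 10) ^+ 2 * b <= u ->
    b - u < (9 / 10) ^+ 2 * b * (9 / 10) by lra.
by rewrite exprMn in m2 *; exact: gen.
Qed.

Let K_bm x : bounded_measurable (K x).
Proof.
split=> //; exists B => y; have /andP[h1 h2] := K_bounds x y.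
by rewrite ger0_norm// (le_trans (ltW m_gt0)).
Qed.

(** Both bounds are row sums. For the upper one, wherever [x2] is, some quarter of the strip lies at
    distance at least [a / 4] from it, and there the quadratic loss of [K_upper] is at least
    [D * (a / 4) ^+ 2]. *)
Lemma strip_eigenvalue_bounds :
  a * (B - c1 * a) <= delta0 rho a <= a * (B - D / 64 * a ^+ 2).
Proof.
have K0 x y : 0 <= K x y.
  by have /andP[h _] := K_bounds x y; rewrite (le_trans (ltW m_gt0)).
have [x1 [x2 [x1a x2a low up]]] :=
  eigenvalue_between_row_sums a_gt0 K_bm K0 KE delta_principal.
have int f : bounded_measurable f -> mu.-integrable `[0, a] (EFin \o f).
  exact: bounded_measurable_integrable.
have Scst c : \int[mu]_(y in `[0, a]) c = c * a.
  by rewrite Rintegral_cst//= lebesgue_measure_itv/= lte_fin a_gt0 sube0.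
apply/andP; split.
  apply: le_trans low; rewrite mulrC -(Scst (B - c1 * a)); apply: le_Rintegral => //.
  - by apply: int; exact: bounded_measurable_cst.
  - exact: int.
apply: le_trans up _.
(* [J] is the outer quarter on the side of the midpoint opposite to [x2]. *)
have [J [mJ Ja muJ far]] : exists J : set R, [/\ measurable J,
    J `<=` `[0, a], mu J = (a / 4)%:E & forall y, J y -> a / 4 <= `|y - x2|].
  move: x2a a_gt0; rewrite in_itv/= => /andP[x20 x2a] a_pos.
  have [h|h] := leP x2 (a / 2).
    exists `[3 / 4 * a, a]%classic; split => //.
    + by move=> y /=; rewrite !in_itv/= => /andP[h1 h2]; apply/andP; split; lra.
    + rewrite lebesgue_measure_itv/= lte_fin ifT; last by lra.
      by rewrite -EFinB; congr (_%:E); field.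
    + move=> y /=; rewrite in_itv/= => /andP[h1 h2].
      by apply: le_trans (ler_norm _); lra.
  exists `[0, a / 4]%classic; split => //.
  + by move=> y /=; rewrite !in_itv/= => /andP[h1 h2]; apply/andP; split; lra.
  + rewrite lebesgue_measure_itv/= lte_fin ifT; last by lra.
    by rewrite sube0.
  + move=> y /=; rewrite in_itv/= => /andP[h1 h2].
    by rewrite distrC; apply: le_trans (ler_norm _); lra.
(* The loss [D * (a / 4) ^+ 2]; over the length [a / 4] it totals [D / 64 * a ^+ 3]. *)
pose w := D / 16 * a ^+ 2.
have w0 : 0 <= w by rewrite mulr_ge0 ?sqr_ge0// divr_ge0// ltW// (rd_D_gt0 rd).
have bJ : bounded_measurable (\1_J : R -> R).
  split; first exact: measurable_indic.
  by exists 1 => y; rewrite indicE; case: (_ \in _); rewrite ?normr1 ?normr0.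
have bwJ : bounded_measurable (fun y => w * \1_J y).
  by apply: bounded_measurableM => //; exact: bounded_measurable_cst.
have SJ : \int[mu]_(y in `[0, a]) (\1_J y) = a / 4.
  have JD : J `&` `[0, a]%classic = J by exact/setIidPl.
  by rewrite /Rintegral integral_indic// JD [X in fine X]muJ.
have -> : a * (B - D / 64 * a ^+ 2) = \int[mu]_(y in `[0, a]) (B - w * \1_J y).
  rewrite RintegralB//; last 2 first.
  - by apply: int; exact: bounded_measurable_cst.
  - exact: int.
  rewrite RintegralZl//; last exact: int.
  by rewrite Scst SJ /w; field.
apply: le_Rintegral => //.
- exact: int.
- apply: int; apply: bounded_measurableB => //; exact: bounded_measurable_cst.
move=> y ya; apply: le_trans (K_upper x2 y) _; rewrite lerD2l lerN2.
rewrite indicE; case: (boolP (y \in J)) => [|_]; last first.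
  by rewrite mulr0 mulr_ge0 ?sqr_ge0// ltW// (rd_D_gt0 rd).
rewrite inE => /far h; rewrite mulr1 !clamp_id//.
rewrite (_ : w = D * (a / 4) ^+ 2); last by rewrite /w; field.
rewrite ler_pM2l ?(rd_D_gt0 rd)// -[leRHS]real_normK ?num_real//.
by rewrite lerXn2r// nnegrE divr_ge0.
Qed.

(** Both sides use ln(1 + t) <= t, at [- w] for the lower bound and at [c1 * a / m] for the upper
    one. *)
Lemma strip_free_energy_bounds :
  D / (64 * B) * a ^+ 2 <= ln a + beta_c_strip rho a - beta_c rho
    <= 2 * c1 / B * a.
Proof.
have /andP[lo up] := strip_eigenvalue_bounds.
rewrite beta_cE /beta_c_strip opprK -/delta.
have d0 : 0 < delta by apply: lt_le_trans lo; rewrite mulr_gt0.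
apply/andP; split.
  pose w := D / (64 * B) * a ^+ 2.
  have up' : delta <= a * (B * (1 - w)).
    apply: le_trans up _; rewrite le_eqVlt; apply/orP; left; apply/eqP.
    by rewrite /w; field; rewrite gt_eqF.
  (* Read off from [0 < delta] and the upper bound on [delta]. *)
  have w1 : 0 < 1 - w.
    have : 0 < a * (B * (1 - w)) by exact: lt_le_trans up'.
    by rewrite !pmulr_rgt0.
  have : ln delta <= ln (a * (B * (1 - w))).
    by rewrite ler_ln// posrE// !mulr_gt0.
  rewrite lnM ?posrE ?mulr_gt0// lnM ?posrE//.
  have := @le_ln1Dx R (- w); rewrite -/w => h.
  have {}h : ln (1 - w) <= - w by apply: h; lra.
  rewrite -/w; lra.
have lnd : ln (a * m) <= ln delta.
  by rewrite ler_ln// posrE// mulr_gt0.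
move: lnd; rewrite lnM ?posrE//.
have : ln (B / m) <= 2 * c1 / B * a.
  have e : B / m = 1 + c1 * a / m by rewrite /m; field; rewrite gt_eqF.
  have ca : 0 < c1 * a / m by rewrite divr_gt0// mulr_gt0.
  rewrite e; apply: le_trans (le_ln1Dx _) _; first lra.
  rewrite ler_pdivrMr//.
  (* It remains to see that [2 * m >= B]. *)
  rewrite (_ : 2 * c1 / B * a * m = c1 * a * (2 * m / B)); last by ring.
  rewrite ler_peMr ?mulr_ge0 ?(ltW c1_gt0)// ler_pdivlMr// mul1r.
  by move: m_ge B_gt0; lra.
rewrite ln_div ?posrE//; lra.
Qed.

End fixed_width.

(** The two entries ensure [a <= 1] and [10 * c1 * a <= B]. *)
Let a0 := Num.min 1 (B / (10 * c1)).

Let a0_gt0 : 0 < a0.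
Proof. by rewrite lt_min ltr01 divr_gt0// mulr_gt0. Qed.

Lemma free_energy_bounds (a : R) : 0 < a -> a < a0 ->
  D / (64 * B) * a ^+ 2 <= ln a + beta_c_strip rho a - beta_c rho
    <= 2 * c1 / B * a.
Proof.
move=> a_gt0; rewrite lt_min => /andP[a1 aB].
apply: strip_free_energy_bounds => //; first exact: ltW.
by move: aB; rewrite ltr_pdivlMr ?mulr_gt0// mulrC => /ltW.
Qed.

Let const_gt0 : 0 < 2 * c1 / B. Proof. by rewrite divr_gt0// mulr_gt0. Qed.

Let near_a0 (P : R -> Prop) : (forall a, 0 < a -> a < a0 -> P a) ->
  \forall a \near 0^'+, P a.
Proof.
move=> h; near=> a; apply: h.
  by near: a; exact: nbhs_right_gt.
by near: a; exact: nbhs_right_lt.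
Unshelve. all: by end_near. Qed.

(** The integrand is constant, so the logarithm of the integral is the quantity of
    [free_energy_bounds]; its nonnegativity and its linear upper bound survive division by [a]. *)
Lemma strip_condition_A : condition_A rho (fun a _ => beta_c_strip rho a).
Proof.
exists a0, (2 * c1 / B); split => // a a_gt0 aa0.
have /andP[h1 h2] := free_energy_bounds a_gt0 aa0.
rewrite Rintegral_cst//= lebesgue_measure_itv/= lte_fin a_gt0 sube0/=.
rewrite lnM ?posrE ?expR_gt0// expRK.
rewrite [a^-1 * _]mulrC; apply/andP; split; last first.
  by rewrite ler_pdivrMr//; lra.
apply: (@le_trans _ _ 0); first by rewrite oppr_le0 ltW.
have w0 : 0 <= D / (64 * B) * a ^+ 2.
  by rewrite mulr_ge0 ?sqr_ge0// divr_ge0 ?mulr_ge0// ltW// (rd_D_gt0 rd).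
by rewrite divr_ge0 ?(ltW a_gt0)//; lra.
Qed.

Lemma strip_asymptotics : [/\ exists C D : R, [/\ 0 < C, 0 < D &
        \forall a \near 0^'+,
          D * a ^+ 2 <= ln a + beta_c_strip rho a - beta_c rho <= C * a],
      condition_A rho (fun a _ => beta_c_strip rho a) &
      a * expR (beta_c_strip rho a) @[a --> 0^'+] --> expR (beta_c rho)].
Proof.
split; last 2 first.
- exact: strip_condition_A.
(* For [a > 0], [a * expR (beta_c_strip rho a)] equals [expR (beta_c rho) * expR (G a)], and [G] is
   squeezed between 0 and a linear function. *)
- pose G a := ln a + beta_c_strip rho a - beta_c rho.
  have G0 : G a @[a --> 0^'+] --> 0.
    apply: (@squeeze_cvgr _ _ _ _ (fun=> 0) (fun a => 2 * c1 / B * a)).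
    + apply: near_a0 => a a_gt0 aa0.
      have /andP[h1 h2] := free_energy_bounds a_gt0 aa0.
      rewrite /G h2 andbT; apply: le_trans h1.
      by rewrite mulr_ge0 ?sqr_ge0// divr_ge0 ?mulr_ge0// ltW// (rd_D_gt0 rd).
    + exact: cvg_cst.
    + apply: cvg_at_right_filter; rewrite -[X in _ --> X](mulr0 (2 * c1 / B)).
      by apply: cvgM; [exact: cvg_cst|exact: cvg_id].
  have cv : expR (beta_c rho) * expR (G a) @[a --> 0^'+] --> expR (beta_c rho).
    rewrite -[X in _ --> X]mulr1 -expR0; apply: cvgM; first exact: cvg_cst.
    exact: (cvg_comp _ _ G0 (@continuous_expR R 0)).
  apply: cvg_trans cv; apply: near_eq_cvg; apply: near_a0 => a a_gt0 _.
  rewrite -expRD /G addrC subrK expRD lnK ?posrE//.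
exists (2 * c1 / B), (D / (64 * B)); split => //.
  by rewrite divr_gt0 ?mulr_gt0// (rd_D_gt0 rd).
exact: near_a0 free_energy_bounds.
Qed.

End strip.

Unset Implicit Arguments.

Theorem theorem1p6 (R : realType) (V : R -> R) (c kappa : R)
  (V_derivable : forall x : R, derivable V x 1)
  (dV_derivable : forall x : R, derivable (V^`())%classic x 1)
  (ddV_continuous : continuous (V^`(2))%classic)
  (V_even : forall x : R, V (- x) = V x)
  (c_gt1 : 1 < c)
  (ddV_bounds : forall x : R, c^-1 <= (V^`(2))%classic x <= c)
  (kappa_gt0 : 0 < kappa)
  (rho_mass : (\int[@lebesgue_measure R]_x
                 (incr_density V kappa x)%:E = 1)%E)
  (rho_var : (\int[@lebesgue_measure R]_x
                 (x ^+ 2 * incr_density V kappa x)%:E = 1)%E) :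
  let rho := incr_density V kappa in
  [/\ exists C D : R, [/\ 0 < C, 0 < D &
        \forall a \near 0^'+,
          D * a ^+ 2 <= ln a + beta_c_strip rho a - beta_c rho <= C * a],
      condition_A rho (fun a _ => beta_c_strip rho a) &
      a * expR (beta_c_strip rho a) @[a --> 0^'+] --> expR (beta_c rho)].
Proof.
have rd := incr_density_regular V_derivable dV_derivable V_even c_gt1 ddV_bounds
  kappa_gt0 rho_mass.
have [L [k [k0 h1 h2 h3 h4]]] := walk_resolvent rd.
exact: strip_asymptotics rd k0 h1 h2 h3 h4.
Qed.
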